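(* Let $\mathbb{G}$ be a homogeneous group with homogeneous dimension $Q$, equipped with a quasi-norm $|\cdot|$. Let $p>1$, $q=p/(p-1)$, and let $f$ and $g$ be nonnegative measurable functions on $\mathbb{G}$. Assume moreover that $F\in L^p(0,\infty)$ and $G\in L^q(0,\infty)$, where $$F(r)=r^{\frac{Q-1}{p}}\int_{\mathfrak{S}} f(rx)\,\mathrm{d}\sigma(x),\qquad G(s)=s^{\frac{Q-1}{q}}\int_{\mathfrak{S}} g(sy)\,\mathrm{d}\sigma(y).$$ Then the following inequality holds: $$\text{(a)}\quad \int_{\mathbb{G}}\int_{\mathbb{G}} \frac{f(x)g(y)}{|x|+|y|} \left(\frac{|x|}{|B(0,|x|)|}\right)^{1/q}\left(\frac{|y|}{|B(0,|y|)|}\right)^{1/p} \mathrm{d}x\,\mathrm{d}y \leq \frac{Q \pi}{\sin (\pi/p)} \left(\int_{\mathbb{G}} f^p(x)\, \mathrm{d}x\right)^{1/p}\left(\int_{\mathbb{G}} g^{q}(y)\, \mathrm{d}y\right)^{1/q}.$$ Moreover, the following two inequalities hold and they are both equivalent to (a): $$\text{(b)}\quad \left(\int_{\mathbb{G}}\left(\int_{\mathbb{G}} \frac{f(x)}{|x|+|y|} \left(\frac{|x|}{|B(0,|x|)|}\right)^{1/q} \mathrm{d}x\right)^p\frac{|y|}{|B(0,|y|)|}\, \mathrm{d}y\right)^{1/p} \leq \frac{Q \pi}{\sin (\pi/p)} \left(\int_{\mathbb{G}} f^p(x)\, \mathrm{d}x\right)^{1/p},$$ $$\text{(c)}\quad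 \left(\int_{\mathbb{G}}\left(\int_{\mathbb{G}} \frac{g(y)}{|x|+|y|} \left(\frac{|y|}{|B(0,|y|)|}\right)^{1/p} \mathrm{d}y\right)^q\frac{|x|}{|B(0,|x|)|}\, \mathrm{d}x\right)^{1/q} \leq \frac{Q \pi}{\sin (\pi/p)} \left(\int_{\mathbb{G}} g^q(y)\, \mathrm{d}y\right)^{1/q}.$$ The constant $\frac{Q\pi}{\sin(\pi/p)}$ is sharp in each of the inequalities (a), (b), (c).
   Context: A homogeneous group $\mathbb{G}$ is a Lie group identified with $(\mathbb{R}^N,\circ)$ equipped with dilations $D_\lambda(x)=(\lambda^{v_1}x_1,\dots,\lambda^{v_N}x_N)$, $v_1,\dots,v_N>0$, which are automorphisms of $\mathbb{G}$ for every $\lambda>0$; one writes $\lambda x$ for $D_\lambda(x)$. Its homogeneous dimension is $Q=v_1+\cdots+v_N$, and its Haar measure $\mathrm{d}x$ is the Lebesgue measure on $\mathbb{R}^N$. A quasi-norm is a continuous function $|\cdot|:\mathbb{G}\to[0,\infty)$ with $|x^{-1}|=|x|$, $|\lambda x|=\lambda|x|$ for all $x\in\mathbb{G}$, $\lambda>0$, and $|x|=0$ iff $x=0$. $\mathfrak{S}=\{x\in\mathbb{G}:|x|=1\}$ is the unit quasi-sphere, and $\sigma$ is the unique Radon measure on $\mathfrak{S}$ such that $\int_{\mathbb{G}}f(x)\,\mathrm{d}x=\int_0^\infty\int_{\mathfrak{S}}f(ry)\,r^{Q-1}\,\mathrm{d}\sigma(y)\,\mathrm{d}r$ for all $f\in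 L^1(\mathbb{G})$. $B(0,|x|)$ is the quasi-ball of radius $|x|$ centered at the origin and $|B(0,|x|)|$ is its Haar measure, so $|B(0,|x|)|=\frac{|\mathfrak{S}|}{Q}|x|^Q$ with $|\mathfrak{S}|=\sigma(\mathfrak{S})$. A constant is sharp (best possible) in an inequality if it cannot be replaced by a smaller constant valid for all admissible functions. *)

(* Defs.v *)
From HB Require Import structures.
From mathcomp Require Import all_boot all_order all_algebra.
From mathcomp Require Import all_classical all_reals all_analysis.

Set Implicit Arguments.
Unset Strict Implicit.
Unset Printing Implicit Defensive.
Import Order.TTheory GRing.Theory Num.Theory.
Import numFieldNormedType.Exports.

Local Open Scope classical_set_scope.
Local Open Scope ring_scope.

From mathcomp Require Import measurable_realfun ring lra.

(** Measurability in R^n is Borel measurability, as it is in R in the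
    library. *)
Section borel.
Variables (R : realType) (n : nat).
Let borel0 := @sigma_algebra0 _ setT (@open 'rV[R]_n).
Let borelC (A : set 'rV[R]_n) : <<s @open 'rV[R]_n >> A ->
    <<s @open 'rV[R]_n >> (~` A).
Proof. by move=> mA; rewrite -setTD; exact: sigma_algebraCD. Qed.
Let borelU := @sigma_algebra_bigcup _ setT (@open 'rV[R]_n).
HB.instance Definition _ := @isMeasurable.Build (sigma_display (@open 'rV[R]_n))
  'rV[R]_n <<s @open 'rV[R]_n >> borel0 borelC borelU.
End borel.

Lemma open_measurable_rV (R : realType) n (U : set 'rV[R]_n) :
  open U -> measurable U.
Proof. by move=> oU; apply: sub_sigma_algebra. Qed.

Lemma continuous_measurable_rV (R : realType) m n
    (f : 'rV[R]_m -> 'rV[R]_n) : continuous f -> measurable_fun setT f.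
Proof.
move=> /continuousP cf.
apply: (@measurability _ _ _ _ _ _ (@open 'rV[R]_n)) => //.
move=> _ [U oU <-]; rewrite setTI; by apply: open_measurable_rV; exact: cf.
Qed.

Section lebesgue_step.
Variables (R : realType) (n : nat).

Definition consv (p : measurableTypeR R * 'rV[R]_n) : 'rV[R]_n.+1 :=
  \row_i oapp (p.2 0) p.1 (unlift ord0 i).

Lemma consv0 p : consv p 0 ord0 = p.1.
Proof. by rewrite mxE unlift_none. Qed.

Lemma consvS p j : consv p 0 (lift ord0 j) = p.2 0 j.
Proof. by rewrite mxE liftK. Qed.

Lemma rational_approx (x e : R) : 0 < e -> exists q : rat, `|x - ratr q| < e.
Proof.
move=> e0; have : x - e < x + e by lra.
move=> /rat_in_itvoo[q]; rewrite in_itv/= => /andP[xq qx].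
by exists q; rewrite ltr_norml; apply/andP; split; lra.
Qed.

Lemma measurable_consv : measurable_fun setT consv.
Proof.
apply: (@measurability _ _ _ _ _ _ (@open 'rV[R]_n.+1)) => //.
move=> _ [U oU <-]; rewrite setTI.
pose B (c : 'rV[rat]_n.+1 * nat) : set 'rV[R]_n.+1 :=
  ball (map_mx ratr c.1 : 'rV[R]_n.+1) (c.2.+1%:R^-1 : R).
have -> : consv @^-1` U =
    \bigcup_(c in [set c | B c `<=` U]) (consv @^-1` (B c)).
  apply/seteqP; split => [p Up|p [c /= cU] /cU //].
  have /nbhs_ballP[e /= e0 eU] : nbhs (consv p) U by exact: open_nbhs_nbhs.
  have [k ke] : exists k : nat, k.+1%:R^-1 < e / 2.
    have /ltr_add_invr[k] : 0 < e / 2 by rewrite divr_gt0.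
    by rewrite add0r; exists k.
  have k0 : 0 < k.+1%:R^-1 :> R by rewrite invr_gt0.
  have /choice[q Hq] : forall i, exists q : rat,
      `|consv p 0 i - ratr q| < k.+1%:R^-1 by move=> i; exact: rational_approx.
  have pB : B (\row_i q i, k) (consv p).
    split => // i j; rewrite (ord1 i) !mxE /ball/= distrC.
    by have := Hq j; rewrite mxE.
  exists (\row_i q i, k) => //= y [_ yB]; apply: eU; split => // i j.
  move: (yB i j) pB.2 => yBij /(_ i j) pBij.
  rewrite (splitr e); apply: (@ball_triangle _ R ((map_mx ratr (\row_i q i) : 'rV[R]_n.+1) i j)).
    by apply: ball_sym; apply: le_ball pBij; exact: ltW.
  by apply: le_ball yBij; exact: ltW.
rewrite bigcup_mkcond; apply: countable_bigcupT_measurable => // c.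
case: ifPn => _ //.
have -> : consv @^-1` (B c) = ball (ratr (c.1 0 ord0) : R) (c.2.+1%:R^-1 : R) `*`
    ball (map_mx ratr (\row_j c.1 0 (lift ord0 j)) : 'rV[R]_n) (c.2.+1%:R^-1 : R).
  apply/seteqP; split => p /=.
    move=> [k0 cB]; split => /=.
      by have := cB 0 ord0; rewrite consv0 mxE.
    by split => // i j; have := cB i (lift ord0 j); rewrite (ord1 i) consvS !mxE.
  move=> [c0 [k0 cB]]; split => // i j; rewrite (ord1 i).
  case: (unliftP ord0 j) => [j' ->|->]; last by rewrite consv0 mxE.
  by have := cB 0 j'; rewrite consvS !mxE.
apply: measurableX; first by apply: open_measurable; exact: ball_open.
apply: open_measurable_rV; exact: ball_open.
Qed.


Definition tailv (x : 'rV[R]_n.+1) : 'rV[R]_n := \row_j x 0 (lift ord0 j).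

Lemma tailv_consv p : tailv (consv p) = p.2.
Proof. by apply/rowP => j; rewrite mxE consvS. Qed.

Lemma measurable_tailv : measurable_fun setT tailv.
Proof.
apply: continuous_measurable_rV => x A /nbhs_ballP[e e0 eA].
apply/nbhs_ballP; exists e => // y [_ xy]; apply: eA.
by split => // i j; rewrite !mxE; exact: xy.
Qed.

Variable mu : {sigma_finite_measure set 'rV[R]_n -> \bar R}.

Definition lebesgue_step : set 'rV[R]_n.+1 -> \bar R :=
  pushforward (product_measure1 lebesgue_measure mu) consv.


Let m1 := product_measure1 lebesgue_measure mu.

Let step0 : lebesgue_step set0 = 0%E.
Proof. by rewrite /lebesgue_step /pushforward preimage_set0 measure0. Qed.

Let step_ge0 A : (0 <= lebesgue_step A)%E.
Proof. by rewrite /lebesgue_step /pushforward. Qed.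

Let step_sigma_additive : semi_sigma_additive lebesgue_step.
Proof. by apply: (@measure_semi_sigma_additive _ _ _ (pushforward m1 consv));
  exact: measurable_consv. Qed.

HB.instance Definition _ := isMeasure.Build _ _ _ lebesgue_step
  step0 step_ge0 step_sigma_additive.

Let step_sigma_finite : sigma_finite setT lebesgue_step.
Proof.
have /sigma_finiteP[F [FT ndF mF]] := sigma_finiteT mu.
exists (fun k => [set x : 'rV[R]_n.+1 | `|x 0 ord0| < k%:R] `&` tailv @^-1` (F k)).
  apply/seteqP; split => // x _.
  have [k Fk] : exists k, F k (tailv x).
    by have : [set: 'rV[R]_n] (tailv x) by []; rewrite FT => -[k _ Fk]; exists k.
  pose m := maxn k (Num.truncn `|x 0 ord0|).+1.
  exists m => //; split => /=.
    rewrite (lt_le_trans (truncnS_gt _))// ler_nat leq_max leqnn orbT//.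
  have /subsetPset : (F k <= F m)%O by apply: ndF; rewrite leq_maxl.
  exact.
move=> k; have [mFk Fkoo] := mF k; split.
  apply: measurableI.
    rewrite (_ : mkset _ = (fun x : 'rV[R]_n.+1 => x 0 ord0) @^-1` (ball (0 : R) k%:R)).
      apply: open_measurable_rV.
      by move/continuousP: (@coord_continuous R 1 n.+1 0 ord0); apply; exact: ball_open.
    by apply/seteqP; split => x /=; rewrite /ball/= sub0r normrN.
  rewrite -[X in measurable X]setTI; exact: measurable_tailv.
have -> : lebesgue_step ([set x : 'rV[R]_n.+1 | `|x 0 ord0| < k%:R] `&` tailv @^-1` (F k)) =
   product_measure1 lebesgue_measure mu (`](- k%:R : R), k%:R[%classic `*` F k).
  congr (product_measure1 _ _ _); apply/seteqP; split => p /=.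
    by move=> [] ; rewrite consv0 tailv_consv in_itv/= ltr_norml.
  by move=> [] ; rewrite consv0 tailv_consv in_itv/= ltr_norml.
rewrite product_measure1E//= lte_mul_pinfty//.
by rewrite lebesgue_measure_itv/=; case: ifP.
Qed.

HB.instance Definition _ := @Measure_isSigmaFinite.Build _ _ _
  lebesgue_step step_sigma_finite.

End lebesgue_step.

(** Iterated product of the Lebesgue measure of R; [lebesgueRn_box] gives its
    values on boxes, which determine it. *)
Fixpoint lebesgueRn (R : realType) (n : nat) :
    {sigma_finite_measure set 'rV[R]_n -> \bar R} :=
  match n with
  | 0 => \d_(0 : 'rV[R]_0)
  | m.+1 => lebesgue_step (lebesgueRn R m)
  end.

Lemma measurable_coord (R : realType) n (i : 'I_n) (A : set R) :
  measurable A -> measurable [set x : 'rV[R]_n | A (x 0 i)].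
Proof.
move=> mA; rewrite -[X in measurable X]setTI.
have mi : measurable_fun setT (fun x : 'rV[R]_n => x 0 i).
  apply: (@measurability _ _ _ _ _ _ (@RGenOpens.G R)).
    exact: RGenOpens.measurableE.
  move=> _ [_ [a [b ->]] <-].
  rewrite setTI; apply: open_measurable_rV.
  move/continuousP: (@coord_continuous R 1 n 0 i); apply.
  exact: interval_open.
exact: mi.
Qed.

Lemma measurable_box (R : realType) n (A : 'I_n -> set R) :
  (forall i, measurable (A i)) ->
  measurable [set x : 'rV[R]_n | forall i, A i (x 0 i)].
Proof.
move=> mA; rewrite (_ : mkset _ = \bigcap_i [set x : 'rV[R]_n | A i (x 0 i)]).
  apply: fin_bigcap_measurable => // i _; exact: measurable_coord.
by apply/seteqP; split => [x Ax i _|x Ax i]; apply: Ax.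
Qed.

Lemma lebesgueRn_box (R : realType) n (A : 'I_n -> set R) :
  (forall i, measurable (A i)) ->
  lebesgueRn R n [set x | forall i, A i (x 0 i)] =
    (\prod_(i < n) lebesgue_measure (A i))%E.
Proof.
elim: n A => [|n IHn] A mA.
  by rewrite big_ord0 /= diracE mem_set// => -[].
rewrite big_ord_recl -IHn; last by move=> i; exact: mA.
rewrite /= /lebesgue_step /pushforward -product_measure1E//.
- congr (product_measure1 _ _ _).
  apply/seteqP; split => p /=.
    move=> Ap; split; first by have := Ap ord0; rewrite consv0.
    by move=> i; have := Ap (lift ord0 i); rewrite consvS.
  move=> [A0 Ap] i; case: (unliftP ord0 i) => [j ->|->].
    by rewrite consvS; exact: Ap.
  by rewrite consv0.
- exact: mA.
- by apply: (measurable_box (A := fun i => A (lift ord0 i))) => i; exact: mA.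
Qed.

Fixpoint Ck (R : realType) (n k : nat) (f : 'rV[R]_n -> R) : Prop :=
  match k with
  | 0 => continuous f
  | l.+1 => continuous f /\ forall i : 'I_n,
      (forall x, derivable f x (delta_mx 0 i)) /\ Ck l ('D_(delta_mx 0 i) f)
  end.

Definition smooth (R : realType) (m n : nat) (f : 'rV[R]_m -> 'rV[R]_n) :=
  forall (k : nat) (i : 'I_n), Ck k (fun x => f x 0 i).

Definition dilation (R : realType) (N : nat) (v : 'I_N -> R) (l : R)
    (x : 'rV[R]_N) : 'rV[R]_N := \row_i (l `^ v i * x 0 i).

(** The identity is taken to be the origin: it is a fixed point of every
    dilation, and the origin is the only one.  Dilations are smooth bijections
    of R^N, so being automorphisms amounts to being morphisms. *)
Record homogeneousGroup (R : realType) (N : nat) := HomogeneousGroup {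
  hmul : 'rV[R]_N -> 'rV[R]_N -> 'rV[R]_N;
  hinv : 'rV[R]_N -> 'rV[R]_N;
  hweight : 'I_N -> R;
  hmulA : associative hmul;
  hmul0x : left_id 0 hmul;
  hmulx0 : right_id 0 hmul;
  hmulVx : left_inverse 0 hinv hmul;
  hmulxV : right_inverse 0 hinv hmul;
  hmul_smooth : smooth (fun z : 'rV[R]_(N + N) => hmul (lsubmx z) (rsubmx z));
  hinv_smooth : smooth hinv;
  hweight_gt0 : forall i, 0 < hweight i;
  dilation_hmul : forall l, 0 < l -> {morph dilation hweight l : x y / hmul x y}
}.

Section homogeneous_group.
Variables (R : realType) (N : nat) (G : homogeneousGroup R N).

Definition dil : R -> 'rV[R]_N -> 'rV[R]_N := dilation (hweight G).

Definition hdim : R := \sum_(i < N) hweight G i.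

Record is_quasi_norm (nu : 'rV[R]_N -> R) : Prop := IsQuasiNorm {
  qnorm_continuous : continuous nu;
  qnorm_ge0 : forall x, 0 <= nu x;
  qnormV : forall x, nu (hinv G x) = nu x;
  qnorm_dil : forall l x, 0 < l -> nu (dil l x) = l * nu x;
  qnorm_eq0 : forall x, nu x = 0 <-> x = 0
}.

Variable nu : 'rV[R]_N -> R.

Definition qball (x : 'rV[R]_N) (r : R) : set 'rV[R]_N :=
  [set y | nu (hmul G (hinv G x) y) < r].

Definition qsphere : set 'rV[R]_N := [set x | nu x = 1].

Local Notation mu := (lebesgueRn R N).

(** [sigma] is a measure on the unit quasi-sphere, seen as a measure on R^N
    giving mass 0 to the complement of the sphere.  The sphere being compact,
    the Radon measures on it are the finite Borel measures. *)
Definition is_polar_measure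
    (sigma : {finite_measure set 'rV[R]_N -> \bar R}) : Prop :=
  sigma (~` qsphere) = 0%E /\
  forall f : 'rV[R]_N -> R, mu.-integrable setT (EFin \o f) ->
    (\int[mu]_x (f x)%:E =
     \int[lebesgue_measure]_(r in `]0%R, +oo[)
       \int[sigma]_(y in qsphere) (f (dil r y) * r `^ (hdim - 1))%:E)%E.

(** The quotient of |x| by |B(0, |x|)|; the ball has finite measure, and the value at the
    origin is [0 / 0 = 0]. *)
Definition ball_ratio (x : 'rV[R]_N) : R := nu x / fine (mu (qball 0 (nu x))).

Section hilbert.
Variable sigma : {finite_measure set 'rV[R]_N -> \bar R}.

Definition radial_mean (p : R) (f : 'rV[R]_N -> R) (r : R) : \bar R :=
  ((r `^ ((hdim - 1) / p))%:E *
   \int[sigma]_(x in qsphere) (f (dil r x))%:E)%E.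

Definition in_Lp_halfline (p : R) (F : R -> \bar R) : Prop :=
  measurable_fun (`]0%R, +oo[ : set R) F /\
  ('N[lebesgue_measure]_(p%:E) [F \_ `]0%R, +oo[] < +oo)%E.

Definition admissible (p : R) (f : 'rV[R]_N -> R) : Prop :=
  [/\ measurable_fun setT f, forall x, 0 <= f x &
      in_Lp_halfline p (radial_mean p f)].

End hilbert.

Definition Lp_norm (p : R) (f : 'rV[R]_N -> R) : \bar R :=
  ((\int[mu]_x (f x `^ p)%:E) `^ p^-1)%E.

Definition hilbert_double (p q C : R) (f g : 'rV[R]_N -> R) : Prop :=
  (\int[mu]_y \int[mu]_x
     (f x * g y / (nu x + nu y) * ball_ratio x `^ q^-1 * ball_ratio y `^ p^-1)%:E
   <= C%:E * Lp_norm p f * Lp_norm q g)%E.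

Definition hilbert_left (p q C : R) (f : 'rV[R]_N -> R) : Prop :=
  ((\int[mu]_y
      ((\int[mu]_x (f x / (nu x + nu y) * ball_ratio x `^ q^-1)%:E) `^ p
       * (ball_ratio y)%:E)) `^ p^-1
   <= C%:E * Lp_norm p f)%E.

Definition hilbert_right (p q C : R) (g : 'rV[R]_N -> R) : Prop :=
  ((\int[mu]_x
      ((\int[mu]_y (g y / (nu x + nu y) * ball_ratio y `^ p^-1)%:E) `^ q
       * (ball_ratio x)%:E)) `^ q^-1
   <= C%:E * Lp_norm q g)%E.

End homogeneous_group.

(* Main.v *)
(** For a function of |x| only, the polar formula and |B(0,|x|)| = c |x|^Q / Q
    with c = sigma(S) give
      int_G (|x| / |B(0,|x|)|) phi(|x|) dx = Q int_0^oo phi(r) dr.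
    This is all that is needed of the polar decomposition.  Inequality (b) is
    the Schur test on G with weights |x|^(1/(pq)): both Schur integrals reduce
    to Q int_0^oo r^(a-1) / (r+s) dr = Q s^(a-1) pi / sin(pi a), with a = 1/q
    and a = 1/p.  Exchanging p and q turns (b) into (c), and Hoelder's
    inequality turns (b) into (a) with the same constant.  Hence each of the
    three inequalities holds with a constant C exactly when C0 <= C, provided
    that (a) is sharp.  For this, take f = |x|^(-Q/p) and g = |x|^(-Q/q) on the
    shell 1 <= |x| <= M: the right-hand side is C c ln M, whereas the left-hand
    side is at least Q c (ln M - 2 ln K) int_(1/K)^K t^(1/q-1) / (1+t) dt; let
    M, then K, tend to infinity.
    The value pi / sin(pi a) of int_0^oo t^(a-1) / (1+t) dt comes from expanding
    1/(1+t) on each side of t = 1 and from the partial fractions of the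
    cotangent, which are obtained by Herglotz' trick. *)

Require Import Defs.
From mathcomp Require Import all_boot all_order all_algebra.
From mathcomp Require Import all_classical all_reals all_analysis.
From mathcomp Require Import measurable_realfun ring lra.

Set Implicit Arguments.
Unset Strict Implicit.
Unset Printing Implicit Defensive.
Import Order.TTheory GRing.Theory Num.Theory.
Import numFieldNormedType.Exports.

Local Open Scope classical_set_scope.
Local Open Scope ring_scope.

(** * Partial fractions of the cosecant *)

Section cosecant.
Context {R : realType}.
Implicit Types (a x K : R) (psi : R -> R).

(* At the supremum of |psi|, halving the argument k times costs a factor 2^k,
   while the linear bound gains 4^k. *)
Lemma herglotz psi K :
  (forall a, 0 < a < 1 -> psi (a / 2) + psi ((a + 1) / 2) = 2 * psi a) ->
  (forall a, 0 < a < 1 -> `|psi a| <= K * a) ->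
  forall a, 0 < a < 1 -> psi a = 0.
Proof.
move=> dup lin.
pose E := [set `|psi a| | a in [set a | 0 < a < 1]].
have h01 : 0 < (2^-1 : R) < 1 by lra.
have K0 : 0 <= K.
  by have := le_trans (normr_ge0 _) (lin _ h01); rewrite pmulr_lge0//; lra.
have hasE : has_sup E.
  split; first by exists `|psi 2^-1|, 2^-1.
  exists K => _ [a /= a01 <-]; apply: (le_trans (lin _ a01)).
  by rewrite ler_piMr//; lra.
set M := sup E.
have leM a : 0 < a < 1 -> `|psi a| <= M.
  by move=> a01; apply: ub_le_sup; [exact: hasE.2 | exists a].
have M0 : 0 <= M by apply: le_trans (leM _ h01); exact: normr_ge0.
have iter_half k a : 0 < a < 1 ->
    `|psi a| <= (2^-1) ^+ k * `|psi (a * (2^-1) ^+ k)| + (1 - (2^-1) ^+ k) * M.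
  move=> a01; elim: k => [|k IH].
    by rewrite expr0 mul1r mulr1 subrr mul0r addr0.
  have r0 : 0 < (2^-1 : R) ^+ k by rewrite exprn_gt0//; lra.
  have r1 : (2^-1 : R) ^+ k <= 1 by rewrite exprn_ile1//; lra.
  have b01 : 0 < a * (2^-1) ^+ k < 1.
    rewrite mulr_gt0//=; last by lra.
    by apply: (@le_lt_trans _ _ a); [rewrite ler_piMr//; lra | lra].
  have c01 : 0 < (a * (2^-1) ^+ k + 1) / 2 < 1 by lra.
  have := dup _ b01; have := leM _ c01.
  rewrite exprSr mulrA.
  set u := psi ((_ + 1) / 2); set v := psi (_ / 2) => uM uv.
  have : `|psi (a * 2^-1 ^+ k)| <= 2^-1 * `|v| + 2^-1 * M.
    rewrite (_ : psi _ = 2^-1 * (v + u)); last by rewrite uv mulrA mulVf ?mul1r.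
    by rewrite normrM ger0_norm; [have := ler_normD v u; lra | lra].
  move=> /(ler_wpM2l (ltW r0)) H; apply: (le_trans IH).
  rewrite [leRHS](_ : _ = (2^-1) ^+ k * (2^-1 * `|v| + 2^-1 * M) +
    (1 - (2^-1) ^+ k) * M); last by field.
  by rewrite lerD2r.
(* The supremum over [a] in [iter_half], with the linear bound at [a / 2^k], gives
   [M <= K / 4^k + (1 - 2^-k) * M], that is [M / 2^k <= K / 4^k]. *)
have Mk k : M <= (2^-1) ^+ k * K.
  have r0 : 0 < (2^-1 : R) ^+ k by rewrite exprn_gt0//; lra.
  have r1 : (2^-1 : R) ^+ k <= 1 by rewrite exprn_ile1//; lra.
  rewrite -(ler_pM2l r0).
  suff : M <= (2^-1) ^+ k * (2^-1 ^+ k * K) + (1 - (2^-1) ^+ k) * M by lra.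
  apply: ge_sup; first by exists `|psi 2^-1|, 2^-1.
  move=> _ [a /= a01 <-]; apply: (le_trans (iter_half k a a01)).
  rewrite lerD2r; apply: ler_wpM2l; first exact: ltW.
  have b01 : 0 < a * (2^-1) ^+ k < 1.
    rewrite mulr_gt0//=; last by lra.
    by apply: (@le_lt_trans _ _ a); [rewrite ler_piMr//; lra | lra].
  apply: (le_trans (lin _ b01)).
  by rewrite [leRHS]mulrC ler_wpM2l// ler_piMl//; lra.
have M_le0 : M <= 0.
  apply: (@cvgr_to_ge _ \oo _ R (fun k => (2^-1) ^+ k * K)); last exact: nearW.
  rewrite -[X in _ --> X](mul0r K); apply: cvgM; last exact: cvg_cst.
  by apply: cvg_expr; rewrite ger0_norm; lra.
move=> a a01; apply/eqP; rewrite -normr_le0.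
exact: le_trans (leM _ a01) M_le0.
Qed.

Lemma xcos_le_sin x : 0 <= x <= pi / 2 -> x * cos x <= sin x.
Proof.
have D (y : R) : is_derive y (1 : R) (sin - id * cos : R -> R) (y * sin y).
  apply: is_derive_eq; rewrite /GRing.scale/=; ring.
move=> /andP[x0 xpi]; rewrite -subr_ge0.
have -> : 0 = (sin - id * cos : R -> R) 0 by rewrite !fctE sin0 mul0r subr0.
apply: (@ger0_derive1_ndecr R _ 0 (pi / 2)) => //.
- move=> y; rewrite in_itv/= => /andP[y0 ypi]; rewrite derive1E derive_val.
  by rewrite mulr_ge0 ?ltW// sin_gt0_pihalf// y0.
- by apply: derivable_within_continuous => y _; exact: ex_derive.
Qed.

(** The difference of the two sides vanishes at [0] and has derivative [y * sin y + y^2 * cos y],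
    which is nonnegative on the first quadrant. *)
Lemma sin_sub_xcos_le x : 0 <= x <= pi / 2 -> sin x - x * cos x <= x ^+ 2 * sin x.
Proof.
have D (y : R) : is_derive y (1 : R) (id ^+ 2 * sin - (sin - id * cos) : R -> R)
    (y * sin y + y ^+ 2 * cos y).
  by apply: is_derive_eq; rewrite /GRing.scale/= !fctE; ring.
move=> /andP[x0 xpi]; rewrite -subr_ge0.
have -> : 0 = (id ^+ 2 * sin - (sin - id * cos) : R -> R) 0.
  by rewrite !fctE sin0 mul0r expr0n mul0r !subr0.
apply: (@ger0_derive1_ndecr R _ 0 (pi / 2)) => //.
- move=> y; rewrite in_itv/= => /andP[y0 ypi]; rewrite derive1E derive_val.
  rewrite addr_ge0// mulr_ge0 ?exprn_ge0 ?ltW//.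
    by rewrite sin_gt0_pihalf// y0.
  by rewrite cos_gt0_pihalf// ypi andbT; have := pi_gt0 R; lra.
- by apply: derivable_within_continuous => y _; exact: ex_derive.
Qed.

(** The two preceding inequalities at [x = pi * a], divided by [a * sin (pi * a)]. The point is that
    the error against the pole [1/a] is linear in [a], as [herglotz] requires. *)
Lemma cot_bounds a : 0 < a <= 1 / 2 ->
  a^-1 - pi ^+ 2 * a <= pi * cos (pi * a) / sin (pi * a) <= a^-1.
Proof.
move=> a01; have pi0 := pi_gt0 R.
have x01 : 0 < pi * a <= pi / 2.
  rewrite mulr_gt0//=; last by lra.
  by rewrite ler_pM2l//; lra.
have x01' : 0 <= pi * a <= pi / 2 by lra.
have s0 : 0 < sin (pi * a) by apply: sin_gt0_pi; lra.
have a0 : 0 < a by lra.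
have := xcos_le_sin x01'; have := sin_sub_xcos_le x01'.
rewrite ler_pdivlMr// ler_pdivrMr//.
set s := sin _; set c := cos _ => H1 H2; apply/andP; split.
  rewrite -(ler_pM2l a0).
  rewrite [a * (_ * s)](_ : _ = s - (pi * a) ^+ 2 * s); last by field; lra.
  by rewrite [a * (_ * c)](_ : _ = pi * a * c); [lra|ring].
rewrite -(ler_pM2l a0) [a * (_ * s)](_ : _ = s); last by field; lra.
by rewrite [a * (_ * c)](_ : _ = pi * a * c); [lra|ring].
Qed.

(* Partial sums of the expansion of [pi * cot (pi * a)], with the terms of
   index [m] and [- m.+1] grouped. *)
Definition kcot n a : R := \sum_(0 <= m < n) ((m%:R + a)^-1 - (m.+1%:R - a)^-1).

Lemma kcotS n a : kcot n.+1 a = kcot n a + ((n%:R + a)^-1 - (n.+1%:R - a)^-1).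
Proof. by rewrite /kcot big_nat_recr. Qed.

(** Up to the factor 2, the fractions in [2m + a] and [2m + 2 - a] come from [a / 2], and those in
    [2m + 1 + a] and [2m + 1 - a] from [(a + 1) / 2]. The grouping of terms makes this exact for
    finite sums, provided the index doubles. *)
Lemma kcot_dup n a : 0 < a < 1 ->
  kcot n (a / 2) + kcot n ((a + 1) / 2) = 2 * kcot n.*2 a.
Proof.
move=> a01; elim: n => [|n IH]; first by rewrite /kcot !big_geq//; ring.
rewrite doubleS !kcotS addrACA IH; move: (kcot _ _) => k.
have n0 : 0 <= n%:R :> R by [].
rewrite -!muln2.
field; do ?[apply/andP; split]; lra.
Qed.

Lemma kcot_sym n a : kcot n (1 - a) = - kcot n a.
Proof.
rewrite /kcot -sumrN; apply: eq_bigr => m _; rewrite [RHS]opprB.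
have -> : m%:R + (1 - a) = m.+1%:R - a by ring.
by have -> : m.+1%:R - (1 - a) = m%:R + a by ring.
Qed.

(** Regrouped, the sum is [1/a] minus a boundary term and the sum of [2a / (m^2 - a^2)] over
    [1 <= m <= n]. Since [a <= 1/2], each of these is at most [2a / (m^2 - 1/4)], which telescopes
    to [2a * (2 - 1/(n + 1/2))]. *)
Lemma kcot_bounds n a : 0 < a <= 1 / 2 ->
  a^-1 - (n.+1%:R - a)^-1 - 2 * a * (2 - (n%:R + 1 / 2)^-1)
    <= kcot n.+1 a <= a^-1 - (n.+1%:R - a)^-1.
Proof.
move=> a01; elim: n => [|n IH].
  by rewrite kcotS /kcot big_geq// !add0r; apply/andP; split; lra.
rewrite kcotS; move: IH.
have n0 : 0 <= n%:R :> R by [].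
set k := kcot _ _; set t := (n.+1%:R - a)^-1; set u := (n.+2%:R - a)^-1.
set v := (_ + a)^-1.
have vt : v <= t by rewrite /t /v lef_pV2 ?posrE; lra.
suff : t - v <= 2 * a * ((n%:R + 1 / 2)^-1 - (n.+1%:R + 1 / 2)^-1) by lra.
rewrite (_ : t - v = 2 * a * ((n%:R + 1) ^+ 2 - a ^+ 2)^-1); last first.
  by rewrite /t /v; field; do ?[apply/andP; split]; nra.
rewrite [X in _ <= _ * X](_ : _ = ((n%:R + 1) ^+ 2 - (1 / 2) ^+ 2)^-1); last first.
  by field; do ?[apply/andP; split]; nra.
by rewrite ler_pM2l ?lef_pV2 ?posrE; nra.
Qed.

(** For [a <= 1/2] every grouped term is nonnegative and the partial sums are bounded by [1/a]; the
    other half of the interval follows from the oddness about [1/2]. *)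
Lemma is_cvg_kcot a : 0 < a < 1 -> cvgn (kcot ^~ a).
Proof.
wlog a2 : a / a <= 1 / 2.
  move=> H a01; have [|/ltW a2] := leP a (1 / 2); first by move=> /H; exact.
  rewrite (_ : kcot ^~ a = - (kcot ^~ (1 - a))); last first.
    by apply/funext => n; rewrite !fctE kcot_sym opprK.
  by apply: is_cvgN; apply: H; lra.
move=> a01; apply: nondecreasing_is_cvgn.
  apply/nondecreasing_seqP => n; rewrite kcotS lerDl subr_ge0 lef_pV2 ?posrE//.
  - by lra.
  - by have : 0 <= n%:R :> R by []; lra.
  - by have : 0 <= n%:R :> R by []; lra.
exists a^-1 => _ [[|n] _ <-].
  by rewrite /kcot big_geq// invr_ge0; lra.
have /andP[_ H] : a^-1 - (n.+1%:R - a)^-1 - 2 * a * (2 - (n%:R + 1 / 2)^-1)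
    <= kcot n.+1 a <= a^-1 - (n.+1%:R - a)^-1 by apply: kcot_bounds; lra.
apply: (le_trans H); rewrite gerBl invr_ge0.
by have : 0 <= n%:R :> R by []; lra.
Qed.

Lemma lim_kcot_bounds a : 0 < a <= 1 / 2 ->
  a^-1 - 4 * a <= limn (kcot ^~ a) <= a^-1.
Proof.
move=> a01; have /is_cvg_kcot ck : 0 < a < 1 by lra.
have H n := kcot_bounds n a01.
apply/andP; split.
  apply: (@ler_cvg_to _ \oo _ R (fun n => a^-1 - 4 * a - 2 * harmonic n)
    (fun n => kcot n.+1 a)).
  - have : a^-1 - 4 * a - 2 * harmonic n @[n --> \oo] --> a^-1 - 4 * a - 2 * 0.
      apply: cvgB; first exact: cvg_cst.
      by apply: cvgM; [exact: cvg_cst|exact: cvg_harmonic].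
    by rewrite mulr0 subr0.
  - exact: (eq_ind_r id ck (cvg_shiftS (kcot ^~ a) _)).
  - apply: nearW => n; have /andP[+ _] := H n; apply: le_trans.
    have n0 : 0 <= n%:R :> R by [].
    have i0 : 0 <= (n%:R + 1 / 2 : R)^-1 by rewrite invr_ge0; lra.
    have : 0 <= a * (n%:R + 1 / 2)^-1 by rewrite mulr_ge0; lra.
    suff : (n.+1%:R - a)^-1 <= 2 * harmonic n by lra.
    rewrite /harmonic/= -[X in X / _]invrK -invfM lef_pV2 ?posrE; lra.
apply: (@cvgr_to_le _ \oo _ R (fun n => kcot n.+1 a)).
  exact: (eq_ind_r id ck (cvg_shiftS (kcot ^~ a) _)).
apply: nearW => n; have /andP[_ +] := H n; move=> /le_trans; apply.
have n0 : 0 <= n%:R :> R by [].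
by rewrite gerBl invr_ge0; lra.
Qed.

(** The difference [psi] of limit and cotangent meets the hypotheses of [herglotz]: the poles [1/a]
    cancel, leaving a linear bound, and both functions obey the duplication formula. *)
Lemma cvg_kcot a : 0 < a < 1 ->
  kcot n a @[n --> \oo] --> pi * cos (pi * a) / sin (pi * a).
Proof.
pose psi a := limn (kcot ^~ a) - pi * cos (pi * a) / sin (pi * a).
suff psi0 : forall a, 0 < a < 1 -> psi a = 0.
  move=> a01; have /eqP := psi0 _ a01; rewrite subr_eq0 => /eqP <-.
  exact: is_cvg_kcot.
have pi0 := pi_gt0 R.
have psi_sym b : 0 < b < 1 -> psi (1 - b) = - psi b.
  move=> b01; rewrite /psi mulrBr mulr1.
  rewrite cosB sinB cospi sinpi !mul0r addr0 add0r !mulN1r opprK.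
  rewrite (_ : kcot ^~ (1 - b) = - (kcot ^~ b)); last first.
    by apply/funext => n; rewrite !fctE kcot_sym.
  rewrite limN; last exact: is_cvg_kcot.
  by rewrite mulrN mulNr opprK opprB addrC.
have psi_le b : 0 < b <= 1 / 2 -> `|psi b| <= (4 + pi ^+ 2) * b.
  move=> b01; have /andP[H1 H2] := lim_kcot_bounds b01.
  have /andP[H3 H4] := cot_bounds b01.
  have : 0 <= pi ^+ 2 * b by rewrite mulr_ge0 ?exprn_ge0//; lra.
  by move=> H5; rewrite /psi ler_norml; apply/andP; split; lra.
apply: (@herglotz _ (4 + pi ^+ 2)) => b b01; last first.
  (* Beyond [1/2] the bound is transported by [psi (1 - b) = - psi b], and [1 - b <= b] there. *)
  have [b2|b2] := leP b (1 / 2); first by apply: psi_le; lra.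
  rewrite -normrN -psi_sym//; apply: (@le_trans _ _ ((4 + pi ^+ 2) * (1 - b))).
    by apply: psi_le; lra.
  by rewrite ler_wpM2l//; [rewrite addr_ge0// exprn_ge0// ltW|lra].
have dbl : (fun n => n.*2) @ \oo --> \oo.
  move=> A [n _ nA]; exists n => // m /= nm; apply: nA => /=.
  by rewrite (leq_trans nm)// -addnn leq_addr.
have lim_dup : limn (kcot ^~ (b / 2)) + limn (kcot ^~ ((b + 1) / 2)) =
    2 * limn (kcot ^~ b).
  have L1 : kcot n (b / 2) + kcot n ((b + 1) / 2) @[n --> \oo] -->
      limn (kcot ^~ (b / 2)) + limn (kcot ^~ ((b + 1) / 2)).
    by apply: cvgD; apply: is_cvg_kcot; lra.
  have L2 : ((fun n => 2 * kcot n b) \o (fun n => n.*2)) n @[n --> \oo] -->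
      2 * limn (kcot ^~ b).
    apply: (@cvg_comp _ _ _ _ (fun n => 2 * kcot n b) _ _ _ dbl).
    apply: cvgM; first exact: cvg_cst.
    exact: is_cvg_kcot.
  move: L1; rewrite (_ : (fun n => _ + _) = (fun n => 2 * kcot n b) \o double).
    by move=> L1; exact: (cvg_unique _ L1 L2).
  by apply/funext => n; rewrite /= -kcot_dup.
rewrite /psi mulrBr -lim_dup.
have h0 : 0 < pi * (b / 2) < pi / 2.
  by rewrite mulr_gt0//= ?ltr_pM2l//; lra.
have := sin_gt0_pihalf h0; have : 0 < cos (pi * (b / 2)).
  by apply: cos_gt0_pihalf; lra.
rewrite (_ : pi * ((b + 1) / 2) = pi * (b / 2) + pi / 2); last by field.
rewrite (_ : pi * b = pi * (b / 2) + pi * (b / 2)); last by field.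
rewrite cosDpihalf sinDpihalf cosD sinD.
set s := sin _; set c := cos _ => c0 s0.
have sc0 := mulr_gt0 s0 c0; move: (limn _) (limn _) => u v.
field; do ?[apply/andP; split]; lra.
Qed.

(** The half-angle identity [2 / sin (2x) = cot x - cot (x + pi/2)] turns two cotangent expansions
    into one of the cosecant. The two sums are kept apart because they arise from the two sides of
    [t = 1] in the integral. *)
Lemma cvg_csc_series a : 0 < a < 1 ->
  \sum_(0 <= m < n) (((m.*2)%:R + a)^-1 - ((m.*2).+1%:R + a)^-1) +
  \sum_(0 <= m < n) (((m.*2).+1%:R - a)^-1 - ((m.*2).+2%:R - a)^-1)
    @[n --> \oo] --> pi / sin (pi * a).
Proof.
move=> a01; have pi0 := pi_gt0 R.
rewrite (_ : (fun n => _) =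
    (fun n => 2^-1 * (kcot n (a / 2) - kcot n ((a + 1) / 2)))); last first.
  apply/funext => n; rewrite /kcot -big_split -sumrB mulr_sumr.
  apply: eq_bigr => m _ /=; rewrite -muln2.
  have m0 : 0 <= m%:R :> R by [].
  by field; do ?[apply/andP; split]; lra.
have h0 : 0 < pi * (a / 2) < pi / 2.
  by rewrite mulr_gt0//= ?ltr_pM2l//; lra.
have : 0 < cos (pi * (a / 2)) by apply: cos_gt0_pihalf; lra.
have := sin_gt0_pihalf h0; have := cos2Dsin2 (pi * (a / 2)).
move=> cs s0 c0.
have -> : pi / sin (pi * a) = 2^-1 * (pi * cos (pi * (a / 2)) / sin (pi * (a / 2))
    - pi * cos (pi * ((a + 1) / 2)) / sin (pi * ((a + 1) / 2))).
  rewrite (_ : pi * ((a + 1) / 2) = pi * (a / 2) + pi / 2); last by field.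
  rewrite (_ : pi * a = pi * (a / 2) + pi * (a / 2)); last by field.
  rewrite cosDpihalf sinDpihalf sinD.
  move: cs s0 c0; set s := sin _; set c := cos _ => cs s0 c0.
  have sc0 := mulr_gt0 s0 c0.
  transitivity (pi * (c ^+ 2 + s ^+ 2) / (2 * s * c)).
    by rewrite cs; field; do ?[apply/andP; split]; lra.
  by field; do ?[apply/andP; split]; lra.
apply: cvgM; first exact: cvg_cst.
by apply: cvgB; apply: cvg_kcot; lra.
Qed.

End cosecant.

(** * The integral of t^(a-1) / (1+t) *)

(** The inverse is written as [x * (x^2)^-1] with a real power, which is measurable; with [0^-1 = 0]
    the identity also holds at the zeros. *)
Lemma measurable_funV d (T : measurableType d) (R : realType) (D : set T)
    (f : T -> R) :
  measurable_fun D f -> measurable_fun D (fun x => (f x)^-1).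
Proof.
move=> mf; rewrite (_ : (fun x => _) = (fun x => f x * (f x ^+ 2) `^ (-1))).
  apply: measurable_funM => //; 
  apply: (@measurableT_comp _ _ _ _ _ _ (fun y : R => y `^ (-1)) _ (fun x => f x ^+ 2)).
    exact: measurable_powR.
  exact: measurable_funX.
apply/funext => x; rewrite powR_inv1 ?sqr_ge0//.
by have [->|fx0] := eqVneq (f x) 0; [rewrite invr0 mul0r|field].
Qed.

Section beta_integral.
Context {R : realType}.
Implicit Types (a b c x t : R) (f F : R -> R).
Local Notation leb := (@lebesgue_measure R).

(** Improper fundamental theorem of calculus: exact on each compact interval, then monotone
    convergence along the nested union. It covers an open end at [0], an unbounded interval and,
    with constant sequences, a compact one. *)
Lemma ge0_FTC_exhaustion f F (l r : R^nat) (L : R) :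
  (forall n, l n < r n) -> {homo l : m n / (m <= n)%N >-> n <= m} ->
  {homo r : m n / (m <= n)%N >-> m <= n} ->
  (forall n t, l n <= t <= r n ->
    [/\ 0 <= f t, {for t, continuous f} & is_derive t (1 : R) F (f t)]) ->
  F (r n) - F (l n) @[n --> \oo] --> L ->
  (\int[leb]_(t in \bigcup_n `[l n, r n]%classic) (f t)%:E = L%:E)%E.
Proof.
move=> lr l_ni r_nd fF FL.
have fc n : {within `[l n, r n], continuous f}.
  apply: continuous_in_subspaceT => t /set_mem /=.
  by rewrite in_itv/= => /fF[].
have H : (\int[leb]_(t in `[l n, r n]) (f t)%:E @[n --> \oo] -->
    \int[leb]_(t in \bigcup_n `[l n, r n]%classic) (f t)%:E)%E.
  apply: ge0_nondecreasing_set_cvg_integral => //.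
  - move=> m n mn; apply/subsetPset; apply: subset_itvScc.
      by rewrite bnd_simp l_ni.
    by rewrite bnd_simp r_nd.
  - move=> n; apply/measurable_EFinP.
    exact: subspace_continuous_measurable_fun.
  - by move=> n t /=; rewrite in_itv/= lee_fin => /fF[].
apply: cvg_unique H _ => //.
have E n : (\int[leb]_(t in `[l n, r n]) (f t)%:E = (F (r n) - F (l n))%:E)%E.
  have dF t : t \in `[l n, r n] -> is_derive t (1 : R) F (f t).
    by rewrite in_itv/= => /fF[].
  rewrite (continuous_FTC2 (F := F))//.
    have cF t : t \in `[l n, r n] -> {for t, continuous F}.
      by move=> /dF[] /derivable1_diffP /differentiable_continuous.
    split.
    - by move=> t /subset_itv_oo_cc /dF[].
    - by apply: cvg_at_right_filter; apply: cF; rewrite in_itv/= lexx ltW.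
    - by apply: cvg_at_left_filter; apply: cF; rewrite in_itv/= lexx ltW.
  by move=> t /subset_itv_oo_cc /dF[_ <-]; rewrite derive1E.
rewrite (_ : (fun n => _) = EFin \o (fun n => F (r n) - F (l n))).
  by apply: cvg_comp FL _.
by apply/funext => n; rewrite E.
Qed.

Lemma cvg_powR_invn b : 0 < b -> n.+2%:R^-1 `^ b @[n --> \oo] --> (0 : R).
Proof.
move=> b0; have /cvg_at_rightP H := powR_cvg0 b0.
apply: (H (fun n => n.+2%:R^-1)); split => [n|]; first by rewrite invr_gt0.
exact: (eq_ind_r id (@cvg_harmonic R) (cvg_shiftS (@harmonic R) _)).
Qed.

Lemma continuous_powR b t : 0 < t -> {for t, continuous (fun u : R => u `^ b)}.
Proof.
move=> t0; apply/differentiable_continuous/derivable1_diffP.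
by apply: derivable_powR; rewrite in_itv/= t0.
Qed.

(** The shift to [n.+2] keeps every interval nondegenerate from [n = 0] on, as the exhaustion lemma
    asks. *)
Lemma bigcup_itv01 : \bigcup_n `[n.+2%:R^-1 : R, 1]%classic = `]0, 1]%classic.
Proof.
apply/seteqP; split => [t [n _]|t] /=; rewrite !in_itv/=.
  by move=> /andP[nt ->]; rewrite (lt_le_trans _ nt).
move=> /andP[t0 t1]; have [n nt] : exists n : nat, n.+1%:R^-1 < t.
  by have := ltr_add_invr t0 => -[n]; rewrite add0r; exists n.
exists n => //=; rewrite in_itv/= t1 andbT (le_trans _ (ltW nt))//.
by rewrite lef_pV2 ?posrE// ler_nat.
Qed.

Lemma bigcup_itv1y : \bigcup_n `[1 : R, n.+2%:R]%classic = `[1, +oo[%classic.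
Proof.
apply/seteqP; split => [t [n _]|t] /=; rewrite !in_itv/=.
  by move=> /andP[-> _].
rewrite andbT => t1; exists (Num.truncn t) => //=; rewrite in_itv/= t1/=.
by rewrite ltW// (lt_le_trans (truncnS_gt t))// ler_nat.
Qed.

Lemma integral_powR_itv01 b : 0 < b ->
  (\int[leb]_(t in `]0%R, 1%R]) (t `^ (b - 1))%:E = b^-1%:E)%E.
Proof.
move=> b0; rewrite -bigcup_itv01.
pose F t := b^-1 * t `^ b.
apply: (@ge0_FTC_exhaustion _ F (fun n => n.+2%:R^-1) (fun=> 1)) => //.
- by move=> n; rewrite invf_lt1// ltr1n.
- by move=> m n mn; rewrite lef_pV2 ?posrE// ler_nat.
- move=> n t /andP[nt t1]; have t0 : 0 < t by rewrite (lt_le_trans _ nt).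
  split; [exact: powR_ge0|exact: continuous_powR|].
  have db := is_derive1_powR b t0.
  by apply: is_derive_eq; rewrite /GRing.scale/= mulrA mulVf ?mul1r; lra.
- rewrite /F powR1 mulr1 -[X in _ --> X]subr0.
  apply: cvgB; first exact: cvg_cst.
  rewrite -[X in _ --> X](mulr0 b^-1).
  by apply: cvgM; [exact: cvg_cst|exact: cvg_powR_invn].
Qed.

Lemma integral_powRB_itv01 a b : 0 < a -> a < b ->
  (\int[leb]_(t in `]0%R, 1%R]) (t `^ (a - 1) - t `^ (b - 1))%:E
   = (a^-1 - b^-1)%:E)%E.
Proof.
move=> a0 ab; rewrite -bigcup_itv01.
pose F t := a^-1 * t `^ a - b^-1 * t `^ b.
apply: (@ge0_FTC_exhaustion _ F (fun n => n.+2%:R^-1) (fun=> 1)) => //.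
- by move=> n; rewrite invf_lt1// ltr1n.
- by move=> m n mn; rewrite lef_pV2 ?posrE// ler_nat.
- move=> n t /andP[nt t1]; have t0 : 0 < t by rewrite (lt_le_trans _ nt).
  split.
  + by rewrite subr_ge0 ger_powR// ?t0//; lra.
  + by apply: continuousB; exact: continuous_powR.
  + have da := is_derive1_powR a t0; have db := is_derive1_powR b t0.
    by apply: is_derive_eq; rewrite /GRing.scale/= !mulrA !mulVf ?mul1r; lra.
- rewrite /F !powR1 !mulr1 -[X in _ --> X]subr0.
  apply: cvgB; first exact: cvg_cst.
  rewrite -(subr0 (0 : R)) -[X in X - _](mulr0 a^-1) -[X in _ - X](mulr0 b^-1).
  by apply: cvgB; (apply: cvgM; [exact: cvg_cst|apply: cvg_powR_invn; lra]).
Qed.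

Lemma integral_powRB_itv1y a b : 0 < a -> a < b ->
  (\int[leb]_(t in `[1%R, +oo[) (t `^ (- a - 1) - t `^ (- b - 1))%:E
   = (a^-1 - b^-1)%:E)%E.
Proof.
move=> a0 ab; rewrite -bigcup_itv1y.
pose F t := b^-1 * t `^ (- b) - a^-1 * t `^ (- a).
apply: (@ge0_FTC_exhaustion _ F (fun=> 1) (fun n => n.+2%:R)) => //.
- by move=> n; rewrite ltr1n.
- by move=> m n mn; rewrite ler_nat.
- move=> n t /andP[t1 nt]; have t0 : 0 < t by rewrite (lt_le_trans _ t1).
  split.
  + by rewrite subr_ge0 ler_powR//; lra.
  + by apply: continuousB; exact: continuous_powR.
  + have da := is_derive1_powR (- a) t0; have db := is_derive1_powR (- b) t0.
    apply: is_derive_eq; rewrite /GRing.scale/= !mulrA !mulrN !mulVf; lra.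
- rewrite /F !powR1 !mulr1 -[X in _ --> X]opprB -[X in _ --> X]sub0r.
  apply: cvgB; last exact: cvg_cst.
  rewrite -(subr0 (0 : R)) -[X in X - _](mulr0 b^-1) -[X in _ - X](mulr0 a^-1).
  have E c n : (n.+2%:R : R) `^ (- c) = n.+2%:R^-1 `^ c.
    by rewrite -(powR_inv1 (ler0n _ n.+2)) -powRrM mulN1r.
  under eq_fun do rewrite !E.
  by apply: cvgB; (apply: cvgM; [exact: cvg_cst|apply: cvg_powR_invn; lra]).
Qed.

(** Consecutive terms of the alternating geometric series are paired: the pairs are nonnegative, so
    that sum and integral can be exchanged by monotone convergence. *)
Lemma nneseries_alt_geometric c x : 0 <= c -> 0 <= x < 1 ->
  (\sum_(0 <= m <oo) (c * (x ^+ m.*2 - x ^+ m.*2.+1))%:E = (c / (1 + x))%:E)%E.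
Proof.
move=> c0 x01.
have E n : \sum_(0 <= m < n) (c * (x ^+ m.*2 - x ^+ m.*2.+1)) =
    c / (1 + x) * (1 - (x ^+ 2) ^+ n).
  elim: n => [|n IH]; first by rewrite big_geq// expr0 subrr mulr0.
  rewrite big_nat_recr//= IH -!exprM !mul2n doubleS !exprS.
  by move: (x ^+ n.*2) => y; field; lra.
apply/cvg_lim => //.
rewrite (_ : (fun n => _) = EFin \o (fun n => c / (1 + x) * (1 - (x ^+ 2) ^+ n))).
  have H : c / (1 + x) * (1 - (x ^+ 2) ^+ n) @[n --> \oo] --> c / (1 + x) * (1 - 0).
    apply: cvgM; first exact: cvg_cst.
    apply: cvgB; first exact: cvg_cst.
    by apply: cvg_expr; rewrite ger0_norm ?exprn_ge0//; nra.
  by rewrite subr0 mulr1 in H; apply: cvg_comp H _.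
by apply/funext => n /=; rewrite sumEFin E.
Qed.

Lemma measurable_beta_integrand a (D : set R) :
  measurable_fun D (fun t => (t `^ (a - 1) / (1 + t))%:E).
Proof.
apply/measurable_EFinP; apply: measurable_funTS.
apply: measurable_funM; first exact: measurable_powR.
by apply: measurable_funV; exact: measurable_funD.
Qed.

Lemma integral_beta a : 0 < a < 1 ->
  (\int[leb]_(t in `]0%R, +oo[) (t `^ (a - 1) / (1 + t))%:E
   = (pi / sin (pi * a))%:E)%E.
Proof.
move=> a01.
(* The exponents produced by the pairs: on [(0, 1)] the expansion in [t] gives
   [t^(u m - 1) - t^(u m)]; on [(1, oo)] the expansion in [1/t] gives
   [t^(- v m - 1) - t^(- v m - 2)]. *)
pose u m : R := (m.*2)%:R + a; pose v m : R := (m.*2).+1%:R - a.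
have u0 m : 0 < u m by rewrite /u ltr_wpDl//; lra.
have v0 m : 0 < v m.
  by rewrite /v; have : 0 <= (m.*2)%:R :> R by []; lra.
have left1 : (\int[leb]_(t in `]0%R, 1%R]) (t `^ (a - 1) / (1 + t))%:E =
    \sum_(0 <= m <oo) ((u m)^-1 - (u m + 1)^-1)%:E)%E.
  (* The point [t = 1], where the geometric series diverges, is discarded. *)
  rewrite -integral_itv_bndo_bndc; last exact: measurable_beta_integrand.
  transitivity (\int[leb]_(t in `]0%R, 1%R[)
      \sum_(0 <= m <oo) (t `^ (u m - 1) - t `^ (u m + 1 - 1))%:E)%E.
    apply: eq_integral => t; rewrite inE/= in_itv/= => /andP[t0 t1].
    rewrite -(@nneseries_alt_geometric _ t) ?powR_ge0 ?ltW//=.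
    apply: eq_eseriesr => m _; congr EFin.
    rewrite mulrBr -!powR_mulrn ?ltW// -!powRD ?(gt_eqF t0) ?implybT//.
    by congr (_ `^ _ - _ `^ _); rewrite /u; ring.
  rewrite integral_nneseries//.
  - apply: eq_eseriesr => m _.
    rewrite -(@integral_powRB_itv01 (u m) (u m + 1))//; last by rewrite ltrDl.
    rewrite integral_itv_bndo_bndc//.
    by apply/measurable_EFinP/measurable_funTS/measurable_funB; exact: measurable_powR.
  - move=> m; apply/measurable_EFinP/measurable_funTS.
    by apply: measurable_funB; exact: measurable_powR.
  - move=> m t /=; rewrite in_itv/= => /andP[t0 t1].
    by rewrite lee_fin subr_ge0 ger_powR// ?t0 ?ltW//; lra.
have right1 : (\int[leb]_(t in `[1%R, +oo[) (t `^ (a - 1) / (1 + t))%:E =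
    \sum_(0 <= m <oo) ((v m)^-1 - (v m + 1)^-1)%:E)%E.
  rewrite -integral_itv_obnd_cbnd; last exact: measurable_beta_integrand.
  transitivity (\int[leb]_(t in `]1%R, +oo[)
      \sum_(0 <= m <oo) (t `^ (- v m - 1) - t `^ (- (v m + 1) - 1))%:E)%E.
    apply: eq_integral => t; rewrite inE/= in_itv/= => /andP[t1 _].
    have t0 : 0 < t by lra.
    transitivity (t `^ (a - 2) / (1 + t^-1))%:E.
      congr EFin; rewrite (_ : a - 1 = a - 2 + 1); last by ring.
      rewrite powRD ?(gt_eqF t0) ?implybT// powRr1 ?ltW//.
      by field; do ?[apply/andP; split]; lra.
    rewrite -nneseries_alt_geometric ?powR_ge0//; last first.
      by rewrite invr_ge0 invf_lt1// t1 ltW.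
    apply: eq_eseriesr => m _; congr EFin.
    rewrite mulrBr !exprVn -!powR_mulrn ?ltW// -!powRN -!powRD ?(gt_eqF t0) ?implybT//.
    by congr (_ `^ _ - _ `^ _); rewrite /v; ring.
  rewrite integral_nneseries//.
  - apply: eq_eseriesr => m _.
    rewrite -(@integral_powRB_itv1y (v m) (v m + 1))//; last by rewrite ltrDl.
    rewrite integral_itv_obnd_cbnd//.
    by apply/measurable_EFinP/measurable_funTS/measurable_funB; exact: measurable_powR.
  - move=> m; apply/measurable_EFinP/measurable_funTS.
    by apply: measurable_funB; exact: measurable_powR.
  - move=> m t /=; rewrite in_itv/= andbT => t1.
    by rewrite lee_fin subr_ge0 ler_powR ?ltW//; lra.
have -> : `]0%R, +oo[%classic = `]0%R, 1%R] `|` `]1%R, +oo[ :> set R.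
  apply/seteqP; split => t /=; rewrite !in_itv/= !andbT.
    by move=> ->; have [|] := leP t 1; [left|right].
  by case=> [/andP[]//|]; lra.
rewrite ge0_integral_setU//=; last 3 first.
- exact: measurable_beta_integrand.
- move=> t /=; rewrite !in_itv/= => t0.
  by rewrite lee_fin divr_ge0 ?powR_ge0//; case: t0; lra.
- apply/disj_setPS => t /= []; rewrite !in_itv/= andbT => /andP[_ t1].
  by rewrite ltNge t1.
rewrite [X in (_ + X)%E]integral_itv_obnd_cbnd; last exact: measurable_beta_integrand.
have pos (w : R) : 0 < w -> 0 <= w^-1 - (w + 1)^-1.
  by move=> w0; rewrite subr_ge0 lef_pV2 ?posrE ?lerDl// addr_gt0.
rewrite left1 right1 -nneseriesD => [|m _ _|m _ _]; [|by rewrite lee_fin pos..].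
apply/cvg_lim => //.
rewrite (_ : (fun n => _) = EFin \o
    (fun n => \sum_(0 <= m < n) ((u m)^-1 - (u m + 1)^-1) +
              \sum_(0 <= m < n) ((v m)^-1 - (v m + 1)^-1))); last first.
  apply/funext => n /=; rewrite -big_split -sumEFin.
  by apply: eq_bigr => m _; rewrite EFinD.
have H := cvg_csc_series a01.
rewrite (_ : (fun n => _) = (fun n =>
  \sum_(0 <= m < n) (((m.*2)%:R + a)^-1 - ((m.*2).+1%:R + a)^-1) +
  \sum_(0 <= m < n) (((m.*2).+1%:R - a)^-1 - ((m.*2).+2%:R - a)^-1))).
  by apply: cvg_comp H _.
apply/funext => n; congr (_ + _); apply: eq_bigr => m _; rewrite /u /v.
  by have -> : m.*2.+1%:R + a = m.*2%:R + a + 1 :> R by ring.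
by have -> : m.*2.+2%:R - a = m.*2.+1%:R - a + 1 :> R by ring.
Qed.

End beta_integral.

(** * The one-dimensional Hilbert kernel *)

Section hilbert_kernel.
Context {R : realType}.
Implicit Types (a b c x t s : R).
Local Notation leb := (@lebesgue_measure R).

(** The right-hand side is a measure in [A] that agrees with Lebesgue measure on the intervals []x,
    y]], so uniqueness applies. *)
Lemma lebesgue_measure_dilation s (A : set R) : 0 < s -> measurable A ->
  (leb A = s%:E * leb (( *%R s) @^-1` A))%E.
Proof.
move=> s0 mA.
have ms : measurable_fun setT ( *%R s : measurableTypeR R -> measurableTypeR R).
  exact: mulrl_measurable.
have s0' : 0 <= s by exact: ltW.
have := @lebesgue_measure_unique R (mscale (NngNum s0')
  (pushforward leb ( *%R s : measurableTypeR R -> measurableTypeR R))).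
move=> /(_ ms _ A) -> // _ [[x y]] _ <-.
transitivity (s%:E * leb `](x / s)%R, (y / s)%R])%E; last first.
  congr (_ * leb _)%E; apply/seteqP; split => t /=;
    by rewrite !in_itv/= ltr_pdivrMr// ler_pdivlMr// ![_ * s]mulrC.
rewrite !lebesgue_measure_itv/= !lte_fin ltr_pM2r ?invr_gt0//.
case: ifPn => _; last by rewrite mule0.
by rewrite -!EFinD -EFinM; congr EFin; field; lra.
Qed.

Lemma ge0_integral_dilation s (D : set R) (f : R -> \bar R) :
  0 < s -> measurable D -> measurable_fun D f -> (forall x, D x -> 0 <= f x)%E ->
  (\int[leb]_(x in D) f x = s%:E * \int[leb]_(x in ( *%R s) @^-1` D) f (s * x)%R)%E.
Proof.
move=> s0 mD mf f0.
have ms : measurable_fun setT ( *%R s : measurableTypeR R -> measurableTypeR R).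
  exact: mulrl_measurable.
have s0' : 0 <= s by exact: ltW.
rewrite -(ge0_integral_pushforward ms)//; last by move=> x /set_mem; exact: f0.
rewrite -(ge0_integral_mscale _ _ (NngNum s0'))//.
by apply: eq_measure_integral => A mA _; exact: lebesgue_measure_dilation.
Qed.

Lemma integral_powR_itv0 b x : 0 < b -> 0 < x ->
  (\int[leb]_(t in `]0%R, x]) (t `^ (b - 1))%:E = (x `^ b / b)%:E)%E.
Proof.
move=> b0 x0; rewrite (ge0_integral_dilation x0)//.
- rewrite (_ : *%R x @^-1` _ = `]0, 1]%classic); last first.
    apply/seteqP; split => t /=; rewrite !in_itv/= pmulr_rgt0//.
      by rewrite -ler_pdivlMl// mulVf// gt_eqF.
    by rewrite -ler_pdivlMl// mulVf// gt_eqF.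
  transitivity (x%:E * \int[leb]_(t in `]0%R, 1%R])
      ((x `^ (b - 1))%:E * (t `^ (b - 1))%:E))%E.
    congr (_ * _)%E; apply: eq_integral.
    move=> t /set_mem/=; rewrite in_itv/= => /andP[t0 _].
    by rewrite -EFinM powRM// ltW.
  rewrite ge0_integralZl//.
  + rewrite integral_powR_itv01// -!EFinM; congr EFin.
    by rewrite mulrA mulr_powRB1// ltW.
  + by apply/measurable_EFinP/measurable_funTS; exact: measurable_powR.
  + by move=> t _; rewrite lee_fin powR_ge0.
  + by rewrite lee_fin powR_ge0.
- by apply/measurable_EFinP/measurable_funTS; exact: measurable_powR.
- by move=> t _; rewrite lee_fin powR_ge0.
Qed.

(** The cut-off stays in the integrand because the polar formula produces this form for the volume
    of a quasi-ball. *)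
Lemma integral_powR_lt b x : 0 < b -> 0 < x ->
  (\int[leb]_(t in `]0%R, +oo[) ((t < x)%R%:R * t `^ (b - 1))%:E =
   (x `^ b / b)%:E)%E.
Proof.
move=> b0 x0; rewrite -integral_powR_itv0// -integral_itv_bndo_bndc; last first.
  by apply/measurable_EFinP/measurable_funTS; exact: measurable_powR.
rewrite (_ : `]0, x[%classic = `]0, +oo[%classic `&` [set t | t < x]).
  rewrite integral_mkcondr; apply: eq_integral => t _.
  rewrite patchE; case: ifPn => [/set_mem/= ->|]; first by rewrite mul1r.
  by rewrite notin_setE/= => /negP/negbTE ->; rewrite mul0r.
by apply/seteqP; split => t /=; rewrite !in_itv/= andbT => /andP.
Qed.

(** Substitution [r = s * t]. The domain is left general: the half-line serves the Schur integrals,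
    a compact interval the sharpness. *)
Lemma hilbert_kernel_dilation a s (D : set R) : 0 < s -> measurable D ->
  D `<=` `]0, +oo[%classic ->
  (\int[leb]_(r in D) (r `^ (a - 1) / (r + s))%:E =
   (s `^ (a - 1))%:E *
   \int[leb]_(t in ( *%R s) @^-1` D) (t `^ (a - 1) / (1 + t))%:E)%E.
Proof.
move=> s0 mD D0.
have D0' t : D t -> 0 < t by move=> /D0/=; rewrite in_itv/= andbT.
have mpre : measurable (( *%R s) @^-1` D).
  rewrite -[X in measurable X]setTI.
  have ms : measurable_fun setT ( *%R s : measurableTypeR R -> measurableTypeR R).
    exact: mulrl_measurable.
  exact: ms.
rewrite (ge0_integral_dilation s0)//; last 2 first.
- apply/measurable_EFinP/measurable_funTS/measurable_funM.
    exact: measurable_powR.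
  by apply: measurable_funV; exact: measurable_funD.
- move=> x /D0' x0; rewrite lee_fin divr_ge0 ?powR_ge0//; lra.
transitivity (s%:E * \int[leb]_(t in ( *%R s) @^-1` D)
    ((s `^ (a - 1) / s)%:E * (t `^ (a - 1) / (1 + t))%:E))%E.
  congr (_ * _)%E; apply: eq_integral => t /set_mem /D0'; rewrite pmulr_rgt0// => t0.
  rewrite -EFinM; congr EFin; rewrite powRM ?ltW//.
  by field; do ?[apply/andP; split]; nra.
rewrite ge0_integralZl//.
- by rewrite muleA -EFinM mulrC divfK// gt_eqF.
- exact: measurable_beta_integrand.
- by move=> t /D0'; rewrite pmulr_rgt0// => t0; rewrite lee_fin divr_ge0 ?powR_ge0//; lra.
- by rewrite lee_fin divr_ge0 ?powR_ge0// ltW.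
Qed.

Lemma integral_hilbert_kernel a s : 0 < a < 1 -> 0 < s ->
  (\int[leb]_(r in `]0%R, +oo[) (r `^ (a - 1) / (r + s))%:E =
   (s `^ (a - 1) * (pi / sin (pi * a)))%:E)%E.
Proof.
move=> a01 s0; rewrite hilbert_kernel_dilation// EFinM -integral_beta//.
congr (_ * integral _ _ _)%E; apply/seteqP; split => t /=;
  by rewrite !in_itv/= !andbT pmulr_rgt0.
Qed.

Lemma cvg_integral_beta_trunc a : 0 < a < 1 ->
  (\int[leb]_(t in `[(n.+2%:R^-1)%R, n.+2%:R%R]) (t `^ (a - 1) / (1 + t))%:E
    @[n --> \oo] --> (pi / sin (pi * a))%:E)%E.
Proof.
move=> a01; rewrite -integral_beta//.
rewrite (_ : `]0, +oo[%classic = \bigcup_n `[n.+2%:R^-1, n.+2%:R]%classic).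
  apply: ge0_nondecreasing_set_cvg_integral => //.
  - move=> m n mn; apply/subsetPset; apply: subset_itvScc; rewrite bnd_simp.
      by rewrite lef_pV2 ?posrE// ler_nat.
    by rewrite ler_nat.
  - by move=> n; exact: measurable_beta_integrand.
  - move=> n t /=; rewrite in_itv/= => /andP[nt _].
    have t0 : 0 < t by rewrite (lt_le_trans _ nt).
    by rewrite lee_fin divr_ge0 ?powR_ge0//; lra.
have E1 := @bigcup_itv01 R; have E2 := @bigcup_itv1y R.
apply/seteqP; split => [t|t [n _]] /=; rewrite !in_itv/= ?andbT; last first.
  by move=> /andP[nt _]; rewrite (lt_le_trans _ nt).
move=> t0; have [t1|t1] := leP t 1.
  have : (\bigcup_n `[n.+2%:R^-1 : R, 1]%classic) t by rewrite E1/= in_itv/= t0.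
  move=> [n _ /=]; rewrite in_itv/= => /andP[nt _]; exists n => //=.
  by rewrite in_itv/= nt (le_trans t1)// ler1n.
have : (\bigcup_n `[1 : R, n.+2%:R]%classic) t by rewrite E2/= in_itv/= ltW.
move=> [n _ /=]; rewrite in_itv/= => /andP[_ nt]; exists n => //=.
by rewrite in_itv/= nt andbT ltW// (le_lt_trans _ t1)// invf_le1// ler1n.
Qed.

Lemma integral_invr_itv x y : 0 < x -> x < y ->
  (\int[leb]_(t in `[x, y]) t^-1%:E = (ln y - ln x)%:E)%E.
Proof.
move=> x0 xy.
rewrite -[X in integral _ X _](@bigcup_const _ nat setT); last by exists 0%N.
apply: (@ge0_FTC_exhaustion _ (fun t : R => t^-1) (@ln R) (fun=> x) (fun=> y)) => //.
- move=> n t /andP[xt ty]; have t0 : 0 < t by rewrite (lt_le_trans _ xt).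
  split; [by rewrite invr_ge0 ltW| |exact: is_derive1_ln].
  by apply: inv_continuous; rewrite gt_eqF.
- exact: cvg_cst.
Qed.

End hilbert_kernel.

(** * Radial integration on the group *)

(** The integral of a nonnegative function is a supremum over simple functions below it, hence
    monotone without measurability. This is needed where a spherical integral is not known to be
    measurable in the radius. *)
Lemma le_integral_nonmeasurable d (T : measurableType d) (R : realType)
    (mu : {measure set T -> \bar R}) (D : set T) (f g : T -> \bar R) :
  (forall x, D x -> 0 <= f x)%E -> (forall x, D x -> f x <= g x)%E ->
  (\int[mu]_(x in D) f x <= \int[mu]_(x in D) g x)%E.
Proof.
move=> f0 fg; have g0 x : D x -> (0 <= g x)%E.
  by move=> Dx; rewrite (le_trans (f0 _ Dx))// fg.
rewrite !ge0_integralE//; apply: ereal_sup_le => _ [h hf <-]; exists h => // x.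
by apply: (le_trans (hf x)); apply: lee_restrict.
Qed.

Lemma continuous_measurable_rV_real (R : realType) n (f : 'rV[R]_n -> R) :
  continuous f -> measurable_fun setT f.
Proof.
move=> /continuousP cf; apply: (measurability _ (RGenOpens.measurableE R)).
move=> _ [_ [a [b ->]] <-]; rewrite setTI; apply: open_measurable_rV.
by apply: cf; exact: interval_open.
Qed.

Lemma cvgn_EFin (R : realType) (u : R^nat) (l : R) :
  u n @[n --> \oo] --> l -> (u n)%:E @[n --> \oo] --> l%:E.
Proof. by move=> ul; exact: (@cvg_comp _ _ _ u EFin _ _ _ ul). Qed.

Lemma cvg_integral_nondecreasing d (T : measurableType d) (R : realType)
    (mu : {measure set T -> \bar R}) (D : set T) (g : nat -> T -> \bar R)
    (f : T -> \bar R) :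
  measurable D -> (forall k, measurable_fun D (g k)) ->
  (forall k x, D x -> 0 <= g k x)%E ->
  (forall x, D x -> nondecreasing_seq (g ^~ x)) ->
  (forall x, D x -> g k x @[k --> \oo] --> f x) ->
  (\int[mu]_(x in D) g k x @[k --> \oo] --> \int[mu]_(x in D) f x)%E.
Proof.
move=> mD mg g0 nd gf.
rewrite (_ : (\int[mu]_(x in D) f x = \int[mu]_(x in D) limn (g ^~ x))%E).
  exact: cvg_monotone_convergence.
by apply: eq_integral => x /set_mem Dx; apply/esym/cvg_lim => //; exact: gf.
Qed.

Lemma measurable_natr d (T : measurableType d) (R : realType) (D : set T)
    (b : T -> bool) :
  measurable_fun D b -> measurable_fun D (fun x => (b x)%:R : R).
Proof.
move=> mb; rewrite (_ : (fun x => _) = (fun x => if b x then 1 else 0 : R)).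
  by move=> mD; exact: measurable_fun_if.
by apply/funext => x; case: (b x).
Qed.

(** In dimension 0 the sphere is empty while the space has mass 1, so the polar formula for the
    constant 1 would read [1 = 0]. *)
Lemma polar_measure_dim_gt0 (R : realType) (N : nat) (G : homogeneousGroup R N)
    (nu : 'rV[R]_N -> R) (sigma : {finite_measure set 'rV[R]_N -> \bar R}) :
  is_quasi_norm G nu -> is_polar_measure G nu sigma -> (0 < N)%N.
Proof.
case: N G nu sigma => // G nu sigma hnu hsigma.
have S0 : qsphere nu = set0.
  apply/seteqP; split => // x; rewrite /qsphere/= (_ : x = 0).
    by rewrite ((qnorm_eq0 hnu 0).2 erefl) => /esym/eqP; rewrite oner_eq0.
  by apply/rowP => -[].
have mu1 : lebesgueRn R 0 setT = 1%E by rewrite /= diracT.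
have i1 : (lebesgueRn R 0).-integrable setT (EFin \o cst 1).
  apply/integrableP; split; first exact/measurable_EFinP.
  rewrite (eq_integral (cst 1%E)); last by move=> x _ /=; rewrite normr1.
  by rewrite integral_cst// mul1e [X in (X < _)%E]mu1 ltry.
have := hsigma.2 _ i1.
rewrite (@integral_cst _ _ _ (lebesgueRn R 0) setT measurableT 1%E) mul1e [LHS]mu1 S0.
rewrite (eq_integral (cst 0%E)); last by move=> t _; rewrite integral_set0.
by rewrite integral0 => /eqP; rewrite onee_eq0.
Qed.

(** * Polar integration of radial functions and volume of quasi-balls *)

Section polar.
Context {R : realType} {N : nat} (G : homogeneousGroup R N) (nu : 'rV[R]_N -> R).
Hypothesis hnu : is_quasi_norm G nu.
Variable sigma : {finite_measure set 'rV[R]_N -> \bar R}.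
Hypothesis hsigma : is_polar_measure G nu sigma.
Local Notation mu := (lebesgueRn R N).
Local Notation leb := (@lebesgue_measure R).
Local Notation Q := (hdim G).
Local Notation S := (qsphere nu).

Lemma measurable_qnorm : measurable_fun setT nu.
Proof. by apply: continuous_measurable_rV_real; exact: qnorm_continuous hnu. Qed.

Lemma measurable_qsphere : measurable S.
Proof.
rewrite (_ : S = setT `&` nu @^-1` [set 1]); first exact: measurable_qnorm.
by rewrite setTI.
Qed.

Lemma qball0E r : qball G nu 0 r = [set y | nu y < r].
Proof.
have h0 : hinv G 0 = 0 by rewrite -[LHS](hmulx0 G) (hmulVx G).
by apply/seteqP; split => y; rewrite /qball/= h0 (hmul0x G).
Qed.

Lemma measurable_qball r : measurable [set y | nu y < r].
Proof.
rewrite (_ : mkset _ = setT `&` nu @^-1` `]-oo, r[); first exact: measurable_qnorm.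
by rewrite setTI; apply/seteqP; split => y /=; rewrite in_itv.
Qed.

Definition sphere_mass : R := fine (sigma S).
Local Notation c := sphere_mass.

Lemma sphere_massE : sigma S = c%:E.
Proof. by rewrite fineK// fin_num_measure//; exact: measurable_qsphere. Qed.

Lemma sphere_mass_ge0 : 0 <= c.
Proof. exact: fine_ge0. Qed.

Lemma hdim_gt0 : 0 < Q.
Proof.
have N0 := polar_measure_dim_gt0 hnu hsigma.
rewrite /hdim (bigD1 (Ordinal N0))//= ltr_pwDl ?hweight_gt0//.
by apply: sumr_ge0 => i _; rewrite ltW// hweight_gt0.
Qed.

Lemma qball_fin r : (mu [set y | (nu y < r)%R] < +oo)%E.
Proof.
have Q0 := hdim_gt0.
have [r0|r0] := leP r 0.
  rewrite (_ : mkset _ = set0) ?measure0//.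
  apply/seteqP; split => // y /= yr.
  by have := qnorm_ge0 hnu y; rewrite leNgt (lt_le_trans yr r0).
(* The ball is cut by sets of finite measure, because the polar formula is only
   available for integrable functions; the cut is not radial, and the spherical
   integral is then not known to be measurable in the radius. *)
have /sigma_finiteP[F [FT ndF mF]] := sigma_finiteT mu.
pose A k := [set y | nu y < r] `&` F k.
have mA k : measurable (A k).
  by apply: measurableI; [exact: measurable_qball|exact: (mF k).1].
have muA k : (mu (A k) < +oo)%E.
  apply: le_lt_trans (mF k).2; apply: (le_measure _ (mem_set (mA k)) (mem_set (mF k).1)).
  exact: subIsetr.
(* The value that the polar formula should give for the whole ball. It bounds the measure of every
   piece, and is finite because [Q > 0]. *)
pose M : \bar R := (\int[leb]_(t in `]0%R, +oo[)
   (((t < r)%R%:R * t `^ (Q - 1))%:E * c%:E))%E.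
have AM k : (mu (A k) <= M)%E.
  have iA : mu.-integrable setT (EFin \o \1_(A k)).
    apply/integrableP; split; first exact/measurable_EFinP/measurable_indic.
    rewrite (eq_integral (fun x => (\1_(A k) x)%:E)).
      by rewrite integral_indic// setIT; exact: muA.
    by move=> t _; rewrite gee0_abs// lee_fin.
  have := hsigma.2 _ iA; rewrite integral_indic// setIT => ->.
  apply: le_integral_nonmeasurable => t /=; rewrite in_itv/= andbT => t0.
    by apply: integral_ge0 => y _; rewrite lee_fin mulr_ge0// powR_ge0.
  rewrite -sphere_massE -(@integral_cst _ _ _ sigma S measurable_qsphere).
  apply: le_integral_nonmeasurable => y Sy.
    by rewrite lee_fin mulr_ge0// powR_ge0.
  rewrite lee_fin ler_wpM2r ?powR_ge0// indicE ler_nat.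
  have [tr|tr] := ltP t r; first by rewrite leq_b1.
  rewrite memNset// => -[/=]; rewrite (qnorm_dil hnu)// Sy mulr1.
  by rewrite ltNge tr.
have Moo : (M < +oo)%E.
  rewrite /M ge0_integralZr//=.
  - by rewrite integral_powR_lt// -EFinM ltry.
  - apply/measurable_EFinP/measurable_funM.
      by apply: measurable_natr; exact: measurable_fun_ltr.
    by apply: measurable_funTS; exact: measurable_powR.
  - by move=> t _; rewrite lee_fin mulr_ge0// powR_ge0.
  - by rewrite lee_fin; exact: sphere_mass_ge0.
apply: (@le_lt_trans _ _ M) => //.
have ndA : nondecreasing_seq A.
  move=> m n mn; apply/subsetPset; apply: setIS; apply/subsetPset; exact: ndF.
have H : mu \o A @ \oo --> mu [set y | nu y < r].
  have := @nondecreasing_cvg_mu _ _ _ mu A mA _ ndA.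
  by rewrite -setI_bigcupr -FT setIT; apply; exact: measurable_qball.
rewrite -(cvg_lim _ H)//; apply: lime_le; first exact: cvgP H.
exact: nearW.
Qed.

Lemma radial_polar_integrable (phi : R -> R) :
  mu.-integrable setT (EFin \o (phi \o nu)) ->
  (\int[mu]_x (phi (nu x))%:E =
   \int[leb]_(t in `]0%R, +oo[) ((phi t * t `^ (Q - 1))%:E * c%:E))%E.
Proof.
move=> iphi; rewrite (hsigma.2 _ iphi); apply: eq_integral => t /set_mem/=.
rewrite in_itv/= andbT => t0.
rewrite (eq_integral (cst (phi t * t `^ (Q - 1))%:E)).
  by rewrite (@integral_cst _ _ _ sigma S measurable_qsphere
    (phi t * t `^ (Q - 1))%:E) [X in (_ * X)%E]sphere_massE.
by move=> y /set_mem Sy /=; rewrite (qnorm_dil hnu)// Sy mulr1.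
Qed.

Lemma radial_polar (phi : R -> R) : measurable_fun setT phi ->
  (forall t, 0 <= phi t) ->
  (\int[mu]_x (phi (nu x))%:E =
   \int[leb]_(t in `]0%R, +oo[) ((phi t * t `^ (Q - 1))%:E * c%:E))%E.
Proof.
move=> mphi phi0.
(* Cutting both the values and the radius at [k] makes the function integrable, balls having finite
   measure; monotone convergence on both sides then removes the cut. *)
pose phik k t : R := Num.min (phi t) k%:R * (t < k%:R)%R%:R.
have phik0 k t : 0 <= phik k t by rewrite mulr_ge0// le_min phi0 ler0n.
have mphik k : measurable_fun setT (phik k).
  apply: measurable_funM; first exact: measurable_minr.
  by apply: measurable_natr; exact: measurable_fun_ltr.
have nd_phik t : nondecreasing_seq (phik ^~ t).
  move=> m n mn; apply: ler_pM => //; first by rewrite le_min phi0 ler0n.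
    by rewrite le_min !ge_min lexx/= ler_nat mn orbT.
  rewrite ler_nat; have [tm|_] := ltP t m%:R; last by [].
  by rewrite (lt_le_trans tm)// ler_nat.
have cvg_phik t : phik k t @[k --> \oo] --> phi t.
  apply: cvg_near_cst; near=> k.
  have tk : Num.max (phi t) t < k%:R by near: k; exact: nbhs_infty_gtr.
  move: tk; rewrite gt_max => /andP[pk tk].
  by rewrite /phik tk mulr1 (min_idPl (ltW pk)).
have iphik k : mu.-integrable setT (EFin \o (phik k \o nu)).
  apply/integrableP; split.
    apply/measurable_EFinP; apply: (measurableT_comp (mphik k)).
    exact: measurable_qnorm.
  apply: (@le_lt_trans _ _ (\int[mu]_(x in [set y | (nu y < k%:R)%R]) k%:R%:E)%E).
    rewrite [leRHS]integral_mkcond; apply: le_integral_nonmeasurable => // x _.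
    rewrite /= ger0_norm// patchE /phik; case: ifPn => [/set_mem/= ->|].
      by rewrite mulr1 lee_fin ge_min lexx orbT.
    by rewrite notin_setE/= => /negP/negbTE ->; rewrite mulr0.
  rewrite integral_cst//; last exact: measurable_qball.
  by rewrite lte_mul_pinfty// qball_fin.
have H1 : (\int[mu]_x (phik k (nu x))%:E @[k --> \oo] --> \int[mu]_x (phi (nu x))%:E)%E.
  apply: cvg_integral_nondecreasing => //.
  - move=> k; apply/measurable_EFinP; apply: (measurableT_comp (mphik k)).
    exact: measurable_qnorm.
  - by move=> k x _; rewrite lee_fin.
  - by move=> x _ m n mn; rewrite lee_fin; exact: nd_phik.
  - by move=> x _; apply: cvgn_EFin; exact: cvg_phik.
have H2 : (\int[leb]_(t in `]0%R, +oo[) ((phik k t * t `^ (Q - 1))%:E * c%:E)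
  @[k --> \oo] -->
   \int[leb]_(t in `]0%R, +oo[) ((phi t * t `^ (Q - 1))%:E * c%:E))%E.
  apply: cvg_integral_nondecreasing => //.
  - move=> k; apply/measurable_EFinP/measurable_funTS/measurable_funM => //.
    by apply: measurable_funM; [exact: mphik|exact: measurable_powR].
  - by move=> k t _; rewrite lee_fin mulr_ge0 ?sphere_mass_ge0// mulr_ge0 ?powR_ge0.
  - move=> t _ m n mn; rewrite lee_fin ler_wpM2r ?sphere_mass_ge0//.
    by rewrite ler_wpM2r ?powR_ge0//; exact: nd_phik.
  - move=> t _; under eq_fun do rewrite -EFinM; rewrite -EFinM.
    have H : phik k t * t `^ (Q - 1) * c @[k --> \oo] --> phi t * t `^ (Q - 1) * c.
      by do 2 (apply: cvgM; last exact: cvg_cst); exact: cvg_phik.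
    exact: cvgn_EFin H.
apply: cvg_unique H1 _ => //.
rewrite (_ : (fun k => _) = (fun k =>
  \int[leb]_(t in `]0%R, +oo[) ((phik k t * t `^ (Q - 1))%:E * c%:E))%E)//.
by apply/funext => k; rewrite radial_polar_integrable.
Unshelve. all: by end_near. Qed.

Lemma qball_measure r : 0 < r -> mu [set y | nu y < r] = (r `^ Q / Q * c)%:E.
Proof.
move=> r0; have Q0 := hdim_gt0.
rewrite -[X in mu X]setIT -integral_indic//; last exact: measurable_qball.
rewrite (eq_integral (fun x => ((nu x < r)%R%:R)%:E)); last first.
  move=> x _; rewrite indicE; congr ((nat_of_bool _)%:R%:E).
  by apply/idP/idP => [/set_mem|xr]; last exact/mem_set.
rewrite (radial_polar (phi := fun t => (t < r)%R%:R))//; last first.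
  by apply: measurable_natr; exact: measurable_fun_ltr.
rewrite ge0_integralZr//=.
- by rewrite integral_powR_lt// -EFinM.
- apply/measurable_EFinP/measurable_funM.
    by apply: measurable_natr; exact: measurable_fun_ltr.
  by apply: measurable_funTS; exact: measurable_powR.
- by move=> t _; rewrite lee_fin mulr_ge0// powR_ge0.
- by rewrite lee_fin; exact: sphere_mass_ge0.
Qed.

Lemma sphere_mass_gt0 : 0 < c.
Proof.
(* Otherwise all balls, hence the whole space, would be null. *)
rewrite lt_neqAle sphere_mass_ge0 andbT; apply/negP => /eqP c0.
pose box : set 'rV[R]_N := [set x | forall i, `[0, 1]%classic (x 0 i)].
have mbox : measurable box.
  by apply: (@measurable_box _ _ (fun=> `[0, 1]%classic)) => i; exact: measurable_itv.
have box1 : mu box = 1%E.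
  rewrite (@lebesgueRn_box _ _ (fun=> `[0, 1]%classic))//.
  by rewrite big1// => i _; rewrite lebesgue_measure_itv/= lte_fin ltr01 sube0.
have mu0 : mu setT = 0%E.
  rewrite (_ : setT = \bigcup_n [set y | nu y < n.+1%:R]).
    apply: measure_negligible.
      by apply: bigcup_measurable => n _; exact: measurable_qball.
    apply: negligible_bigcup => n; apply/negligibleP; first exact: measurable_qball.
    by rewrite [LHS]qball_measure// -c0 mulr0.
  apply/seteqP; split => // y _; exists (Num.truncn (nu y)) => //=.
  exact: truncnS_gt.
have := @le_measure _ _ _ mu box setT (mem_set mbox) (mem_set measurableT) (@subsetT _ _).
by rewrite [leLHS]box1 [leRHS]mu0 leNgt lte01.
Qed.

Definition radial_ratio t : R := t / (t `^ Q / Q * c).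

Lemma ball_ratioE x : ball_ratio G nu x = radial_ratio (nu x).
Proof.
rewrite /ball_ratio /radial_ratio qball0E.
have := qnorm_ge0 hnu x; rewrite le_eqVlt => /predU1P[<-|x0].
  by rewrite !mul0r.
by rewrite qball_measure.
Qed.

Lemma ball_ratio_eq0 x : nu x = 0 -> ball_ratio G nu x = 0.
Proof. by rewrite /ball_ratio => ->; rewrite mul0r. Qed.

Lemma radial_ratioE t : 0 < t -> radial_ratio t = Q / c * t `^ (1 - Q).
Proof.
move=> t0; have Q0 := hdim_gt0; have c0 := sphere_mass_gt0.
have tQ0 : 0 < t `^ Q by rewrite powR_gt0.
rewrite /radial_ratio powRB ?(gt_eqF t0) ?implybT// powRr1 ?ltW//.
by field; do ?[apply/andP; split]; lra.
Qed.

Lemma radial_ratio_ge0 t : 0 <= t -> 0 <= radial_ratio t.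
Proof.
move=> t0; have := hdim_gt0; have := sphere_mass_ge0 => c0 Q0.
by rewrite /radial_ratio !(divr_ge0, mulr_ge0) ?powR_ge0// ltW.
Qed.

Lemma measurable_radial_ratio : measurable_fun setT radial_ratio.
Proof.
apply: measurable_funM => //; apply: measurable_funV.
do 2 (apply: measurable_funM => //); exact: measurable_powR.
Qed.

Lemma ball_ratio_ge0 x : 0 <= ball_ratio G nu x.
Proof. by rewrite ball_ratioE radial_ratio_ge0//; exact: qnorm_ge0 hnu x. Qed.

Lemma measurable_ball_ratio : measurable_fun setT (ball_ratio G nu).
Proof.
rewrite (_ : ball_ratio G nu = radial_ratio \o nu).
  by apply: measurableT_comp; [exact: measurable_radial_ratio|exact: measurable_qnorm].
by apply/funext => x; rewrite ball_ratioE.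
Qed.

(** The weight is [(Q / c) * t^(1 - Q)]: it cancels the density [t^(Q - 1)] and the mass [c] of the
    sphere. Only the factor [Q] of the final constant survives. *)
Lemma integral_ball_ratio (phi : R -> R) : measurable_fun setT phi ->
  (forall t, 0 <= t -> 0 <= phi t) ->
  (\int[mu]_x (ball_ratio G nu x * phi (nu x))%:E =
   Q%:E * \int[leb]_(t in `]0%R, +oo[) (phi t)%:E)%E.
Proof.
move=> mphi phi0; have Q0 := hdim_gt0; have c0 := sphere_mass_gt0.
(* [radial_polar] asks for nonnegativity at every real [t], whereas [phi] is controlled only for
   [t >= 0]; the absolute value changes nothing at the values of [nu]. *)
pose psi t : R := `|radial_ratio t * phi t|.
rewrite (eq_integral (fun x => (psi (nu x))%:E)); last first.
  move=> x _; rewrite /psi ball_ratioE ger0_norm// mulr_ge0//.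
    by rewrite radial_ratio_ge0//; exact: qnorm_ge0 hnu x.
  by rewrite phi0//; exact: qnorm_ge0 hnu x.
have mpsi : measurable_fun setT psi.
  have m : measurable_fun setT (fun t => radial_ratio t * phi t).
    by apply: measurable_funM => //; exact: measurable_radial_ratio.
  exact: (measurableT_comp (@normr_measurable R setT) m).
rewrite (radial_polar mpsi) => [|t]; last by rewrite /psi.
rewrite -ge0_integralZl//=.
- apply: eq_integral => t /set_mem/=; rewrite in_itv/= andbT => t0.
  rewrite -!EFinM; congr EFin; rewrite /psi ger0_norm; last first.
    by rewrite mulr_ge0 ?radial_ratio_ge0 ?phi0// ltW.
  rewrite radial_ratioE//.
  have H : t `^ (1 - Q) * t `^ (Q - 1) = 1.
    rewrite -powRD ?(gt_eqF t0) ?implybT//.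
    by rewrite (_ : 1 - Q + (Q - 1) = 0) ?powRr0//; ring.
  transitivity (Q * phi t * (t `^ (1 - Q) * t `^ (Q - 1))); last by rewrite H mulr1.
  by field; lra.
- by apply/measurable_EFinP; exact: measurable_funTS.
- by move=> t; rewrite in_itv/= andbT => t0; rewrite lee_fin phi0// ltW.
- by rewrite lee_fin ltW.
Qed.

End polar.

(** * Hilbert's inequality by the Schur test *)

Section hoelder_ge0.
Context d (T : measurableType d) (R : realType).
Variable mu : {measure set T -> \bar R}.
Variables p q : R.
Hypotheses (p0 : 0 < p) (q0 : 0 < q) (pq : p^-1 + q^-1 = 1).

Lemma hoelder_ge0 (u v : T -> R) :
  measurable_fun setT u -> measurable_fun setT v ->
  (forall x, 0 <= u x) -> (forall x, 0 <= v x) ->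
  (\int[mu]_x (u x * v x)%:E <=
   (\int[mu]_x (u x `^ p)%:E) `^ p^-1 * (\int[mu]_x (v x `^ q)%:E) `^ q^-1)%E.
Proof.
move=> mu_ mv u0 v0; have := hoelder mu mu_ mv p0 q0 pq.
rewrite Lnorm1 unlock.
rewrite (eq_integral (fun x => (u x * v x)%:E)); last first.
  by move=> x _; rewrite /= ger0_norm// mulr_ge0.
rewrite [X in (_ <= X `^ _ * _)%E -> _](eq_integral (fun x => (u x `^ p)%:E)); last first.
  by move=> x _; rewrite /= ger0_norm.
rewrite [X in (_ <= _ * X `^ _)%E -> _](eq_integral (fun x => (v x `^ q)%:E)) //.
by move=> x _; rewrite /= ger0_norm.
Qed.

(** When [h = +oo] and [g = 0], all truncated products vanish, which agrees with the convention
    [+oo * 0 = 0]. *)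
Lemma cvg_mine_mul (h : \bar R) (g : R) : (0 <= h)%E -> 0 <= g ->
  (fine (Order.min h k%:R%:E) * g)%:E @[k --> \oo] --> (h * g%:E)%E.
Proof.
case: h => [r| |] // r0 g0.
  apply: cvg_near_cst; near=> k.
  have rk : r < k%:R by near: k; exact: nbhs_infty_gtr.
  by rewrite min_l ?lee_fin ?ltW// -EFinM.
rewrite (_ : (fun k => _) = (fun k => (k%:R * g)%:E)); last first.
  by apply/funext => k; rewrite min_r ?leey.
move: g0; rewrite le_eqVlt => /predU1P[<-|g0].
  by rewrite mule0; under eq_fun do rewrite mulr0; exact: cvg_cst.
rewrite gt0_mulye ?lte_fin//; apply/cvgeryP.
apply/cvgryPge => A; near=> k; rewrite -ler_pdivrMr//.
by near: k; exact: nbhs_infty_ger.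
Unshelve. all: by end_near. Qed.

(** One factor may be infinite, as the inner integral of (b) can be. It is truncated at [k], and
    monotone convergence passes to the limit. *)
Lemma ehoelder_ge0 (h : T -> \bar R) (g : T -> R) :
  measurable_fun setT h -> measurable_fun setT g ->
  (forall x, 0 <= h x)%E -> (forall x, 0 <= g x) ->
  (\int[mu]_x (h x * (g x)%:E) <=
   (\int[mu]_x (h x `^ p)) `^ p^-1 * (\int[mu]_x (g x `^ q)%:E) `^ q^-1)%E.
Proof.
move=> mh mg h0 g0.
pose hk k x : R := fine (Order.min (h x) k%:R%:E).
have hkE k x : (hk k x)%:E = Order.min (h x) k%:R%:E.
  rewrite fineK// ge0_fin_numE ?le_min ?h0 ?lee_fin ?ler0n//.
  by rewrite gt_min ltry orbT.
have hk0 k x : 0 <= hk k x by rewrite -lee_fin hkE le_min h0 lee_fin ler0n.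
have mhk k : measurable_fun setT (hk k).
  apply: measurableT_comp; first exact: fine_measurable.
  exact: measurable_mine.
have H : (\int[mu]_x (hk k x * g x)%:E @[k --> \oo] --> \int[mu]_x (h x * (g x)%:E))%E.
  apply: cvg_integral_nondecreasing => //.
  - by move=> k; apply/measurable_EFinP/measurable_funM.
  - by move=> k x _; rewrite lee_fin mulr_ge0.
  - move=> x _ m n mn; rewrite lee_fin ler_wpM2r// -lee_fin !hkE.
    by rewrite le_min !ge_min lexx/= lee_fin ler_nat mn orbT.
  - by move=> x _; exact: cvg_mine_mul.
rewrite -(cvg_lim _ H)//; apply: lime_le; first exact: cvgP H.
apply: nearW => k; apply: le_trans (hoelder_ge0 (mhk k) mg (hk0 k) g0) _.
rewrite lee_wpmul2r ?poweR_ge0//; apply: gt0_ler_poweR.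
- by rewrite invr_ge0 ltW.
- by rewrite in_itv/= leey andbT integral_ge0// => x _; rewrite lee_fin powR_ge0.
- by rewrite in_itv/= leey andbT integral_ge0// => x _; rewrite poweR_ge0.
apply: le_integral_nonmeasurable => x _; first by rewrite lee_fin powR_ge0.
rewrite -poweR_EFin; apply: gt0_ler_poweR; first exact: ltW.
- by rewrite in_itv/= leey lee_fin hk0.
- by rewrite in_itv/= leey h0.
- by rewrite hkE ge_min lexx.
Qed.

End hoelder_ge0.

(** * The Schur test on the group, and the passage from (b) to (a) *)

Section hilbert_inequality.
Context {R : realType} {N : nat} (G : homogeneousGroup R N) (nu : 'rV[R]_N -> R).
Hypothesis hnu : is_quasi_norm G nu.
Variable sigma : {finite_measure set 'rV[R]_N -> \bar R}.
Hypothesis hsigma : is_polar_measure G nu sigma.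
Variables p q : R.
Hypotheses (p0 : 0 < p) (q0 : 0 < q) (pq : p^-1 + q^-1 = 1).
Local Notation mu := (lebesgueRn R N).
Local Notation leb := (@lebesgue_measure R).
Local Notation Q := (hdim G).
Local Notation br := (ball_ratio G nu).
Local Notation C0 := (Q * pi / sin (pi / p)).

Let nu0 x : 0 <= nu x. Proof. exact: (qnorm_ge0 hnu x). Qed.
Let br0 x : 0 <= br x. Proof. exact: (ball_ratio_ge0 hnu hsigma x). Qed.
Let mnu : measurable_fun setT nu. Proof. exact: (measurable_qnorm hnu). Qed.
Let mbr : measurable_fun setT br.
Proof. exact: (measurable_ball_ratio hnu hsigma). Qed.

Let ip01 : 0 < p^-1 < 1.
Proof. by rewrite invr_gt0 p0/= -pq ltrDl invr_gt0. Qed.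
Let iq01 : 0 < q^-1 < 1.
Proof. by rewrite invr_gt0 q0/= -pq ltrDr invr_gt0. Qed.

Let iqE : q^-1 = 1 - p^-1. Proof. by rewrite -pq addrAC subrr add0r. Qed.

Lemma sin_conjugate : sin (pi / q) = sin (pi / p).
Proof.
rewrite (_ : pi / q = pi - pi / p); last first.
  by rewrite iqE; ring.
by rewrite sinB sinpi cospi mul0r sub0r mulN1r opprK.
Qed.

Lemma hilbert_constant_gt0 : 0 < C0.
Proof.
rewrite divr_gt0// ?mulr_gt0 ?pi_gt0 ?(hdim_gt0 hnu hsigma)//.
apply: sin_gt0_pi; rewrite divr_gt0 ?pi_gt0//=.
by rewrite gtr_pMr ?pi_gt0//; case/andP: ip01.
Qed.

Lemma integral_ball_ratio_kernel a y : 0 < a < 1 -> 0 < nu y ->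
  (\int[mu]_x (br x * (nu x `^ (a - 1) / (nu x + nu y)))%:E =
   (Q * (nu y `^ (a - 1) * (pi / sin (pi * a))))%:E)%E.
Proof.
move=> a01 y0.
rewrite (integral_ball_ratio hnu hsigma (phi := fun t => t `^ (a - 1) / (t + nu y))).
- by rewrite integral_hilbert_kernel// -EFinM.
- apply: measurable_funM; first exact: measurable_powR.
  by apply: measurable_funV; exact: measurable_funD.
- by move=> t t0; rewrite divr_ge0 ?powR_ge0// addr_ge0.
Qed.

Let m1 (f : 'rV[R]_N -> R) : measurable_fun setT f ->
  measurable_fun setT (fun z : 'rV[R]_N * 'rV[R]_N => f z.1).
Proof. by move=> mf; apply: (measurableT_comp mf); exact: measurable_fst. Qed.
Let m2 (f : 'rV[R]_N -> R) : measurable_fun setT f ->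
  measurable_fun setT (fun z : 'rV[R]_N * 'rV[R]_N => f z.2).
Proof. by move=> mf; apply: (measurableT_comp mf); exact: measurable_snd. Qed.
Let mpowR (f : 'rV[R]_N -> R) a : measurable_fun setT f ->
  measurable_fun setT (fun x => f x `^ a).
Proof. by move=> mf; exact: (measurableT_comp (@measurable_powR R a) mf). Qed.

Variable f : 'rV[R]_N -> R.
Hypotheses (mf : measurable_fun setT f) (f0 : forall x, 0 <= f x).

Let T y : \bar R := (\int[mu]_x (f x / (nu x + nu y) * br x `^ q^-1)%:E)%E.

Lemma measurable_hilbert_operator : measurable_fun setT T.
Proof.
pose F (z : 'rV[R]_N * 'rV[R]_N) : \bar R :=
  (f z.1 / (nu z.1 + nu z.2) * br z.1 `^ q^-1)%:E.
apply: (@measurable_fun_fubini_tonelli_G _ _ _ _ _ mu F).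
- apply/measurable_EFinP; apply: measurable_funM; last exact: (m1 (mpowR _ mbr)).
  apply: measurable_funM; first exact: m1.
  by apply: measurable_funV; apply: measurable_funD; [exact: m1|exact: m2].
- by move=> z; rewrite lee_fin mulr_ge0 ?powR_ge0// divr_ge0// addr_ge0.
Qed.

Lemma hilbert_operator_ge0 y : (0 <= T y)%E.
Proof.
apply: integral_ge0 => x _.
by rewrite lee_fin mulr_ge0 ?powR_ge0// divr_ge0// addr_ge0.
Qed.

Let I y : \bar R := (\int[mu]_x (f x `^ p * nu x `^ q^-1 / (nu x + nu y))%:E)%E.

(* Hoelder with the Schur weights nu^(1/(pq)) and nu^(-1/(pq)). *)
Lemma hilbert_operator_le y : 0 < nu y ->
  (T y <= I y `^ p^-1 * ((C0 * nu y `^ (- p^-1)) `^ q^-1)%:E)%E.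
Proof.
move=> y0.
have d0 x : 0 < nu x + nu y by rewrite ltr_wpDl.
pose u x := f x * nu x `^ (p^-1 * q^-1) * (nu x + nu y) `^ (- p^-1).
pose v x := br x `^ q^-1 * nu x `^ (- (p^-1 * q^-1)) * (nu x + nu y) `^ (- q^-1).
have md : measurable_fun setT (fun x => nu x + nu y) by exact: measurable_funD.
have mu_ : measurable_fun setT u.
  apply: measurable_funM; last exact: mpowR.
  by apply: measurable_funM => //; exact: mpowR.
have mv : measurable_fun setT v.
  apply: measurable_funM; last exact: mpowR.
  by apply: measurable_funM; exact: mpowR.
have u0 x : 0 <= u x by rewrite !mulr_ge0 ?powR_ge0.
have v0 x : 0 <= v x by rewrite !mulr_ge0 ?powR_ge0.
have uv x : u x * v x = f x / (nu x + nu y) * br x `^ q^-1.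
  have D : (nu x + nu y) `^ (- p^-1) * (nu x + nu y) `^ (- q^-1) = (nu x + nu y)^-1.
    rewrite -powRD ?(gt_eqF (d0 x)) ?implybT// -opprD pq.
    by rewrite powR_inv1// ltW.
  (* At the origin the two Schur weights do not multiply to 1, but both sides vanish with [br x]. *)
  have [x0|x0] := eqVneq (nu x) 0.
    rewrite /u /v (_ : br x = 0); last exact: ball_ratio_eq0.
    by rewrite powR0 ?mulr0 ?mul0r ?mulr0// invr_neq0// gt_eqF.
  have E : nu x `^ (p^-1 * q^-1) * nu x `^ (- (p^-1 * q^-1)) = 1.
    by rewrite -powRD ?x0 ?implybT// subrr powRr0.
  rewrite -D /u /v; move: E.
  set A := nu x `^ _; set B := nu x `^ _ => E.
  transitivity (f x * (A * B) * ((nu x + nu y) `^ (- p^-1) *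
    (nu x + nu y) `^ (- q^-1)) * br x `^ q^-1); first by ring.
  by rewrite E mulr1.
have up x : u x `^ p = f x `^ p * nu x `^ q^-1 / (nu x + nu y).
  rewrite /u !powRM ?mulr_ge0 ?powR_ge0// -!powRrM.
  rewrite (_ : p^-1 * q^-1 * p = q^-1); last by rewrite mulrAC mulVf ?gt_eqF ?mul1r.
  by rewrite mulNr mulVf ?gt_eqF// powR_inv1// ltW.
(* The exponent is [- 1/p = 1/q - 1], so the integral of [v^q] is the Schur integral with
   [a = 1/q]. *)
have vq x : v x `^ q = br x * (nu x `^ (q^-1 - 1) / (nu x + nu y)).
  rewrite /v; move: (br x) (br0 x) => b b0.
  rewrite !powRM ?mulr_ge0 ?powR_ge0// -!powRrM mulVf ?gt_eqF// powRr1//.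
  rewrite (_ : - (p^-1 * q^-1) * q = q^-1 - 1); last first.
    by rewrite mulNr -mulrA mulVf ?gt_eqF// mulr1 iqE; ring.
  by rewrite mulNr mulVf ?gt_eqF// powR_inv1 ?ltW// mulrA.
have TE : T y = (\int[mu]_x (u x * v x)%:E)%E.
  by apply: eq_integral => x _; rewrite uv.
have IE : I y = (\int[mu]_x (u x `^ p)%:E)%E.
  by apply: eq_integral => x _; rewrite up.
have VE : (\int[mu]_x (v x `^ q)%:E =
    \int[mu]_x (br x * (nu x `^ (q^-1 - 1) / (nu x + nu y)))%:E)%E.
  by apply: eq_integral => x _; rewrite vq.
rewrite TE IE; apply: le_trans (hoelder_ge0 mu p0 q0 pq mu_ mv u0 v0) _.
rewrite VE integral_ball_ratio_kernel// poweR_EFin.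
rewrite (_ : q^-1 - 1 = - p^-1); last by rewrite iqE; ring.
by rewrite sin_conjugate (_ : Q * _ = C0 * nu y `^ (- p^-1)) //; ring.
Qed.

(** The bound of [hilbert_operator_le] raised to the power [p] and multiplied by [br y], before
    integration in [x]. Its exponents come from [p / q = p - 1] and [(p - 1) / p = 1/q]. *)
Let W x y : R := f x `^ p * nu x `^ q^-1 / (nu x + nu y) *
  (C0 `^ (p - 1) * nu y `^ (- q^-1) * br y).

Let C0_ge0 : 0 <= C0. Proof. exact: (ltW hilbert_constant_gt0). Qed.

Let k0 y : 0 <= C0 `^ (p - 1) * nu y `^ (- q^-1) * br y.
Proof. by apply: mulr_ge0 (br0 y); rewrite mulr_ge0 ?powR_ge0. Qed.

Let w0 x y : 0 <= f x `^ p * nu x `^ q^-1 / (nu x + nu y).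
Proof. by rewrite divr_ge0 ?mulr_ge0 ?powR_ge0// addr_ge0. Qed.

Let mI x : measurable_fun setT (fun y => f y `^ p * nu y `^ q^-1 / (nu y + nu x)).
Proof.
apply: measurable_funM; last by apply: measurable_funV; exact: measurable_funD.
by apply: measurable_funM; exact: mpowR.
Qed.

Let hilbert_operator_powR_le y :
  (T y `^ p * (br y)%:E <= \int[mu]_x (W x y)%:E)%E.
Proof.
have [y0|y0] := eqVneq (nu y) 0.
  rewrite (_ : br y = 0) ?mule0; last exact: ball_ratio_eq0.
  by apply: integral_ge0 => x _; rewrite lee_fin mulr_ge0.
have {}y0 : 0 < nu y by rewrite lt_neqAle eq_sym y0 nu0.
have -> : (\int[mu]_x (W x y)%:E =
    I y * (C0 `^ (p - 1) * nu y `^ (- q^-1) * br y)%:E)%E.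
  rewrite -ge0_integralZr//.
  - exact/measurable_EFinP.
  - by move=> x _; rewrite lee_fin.
  - by rewrite lee_fin.
rewrite [X in (_ <= _ * X)%E]EFinM muleA lee_wpmul2r ?lee_fin//.
have I0 : (0 <= I y)%E by apply: integral_ge0 => x _; rewrite lee_fin.
have H : (T y `^ p <=
    (I y `^ p^-1 * ((C0 * nu y `^ (- p^-1)) `^ q^-1)%:E) `^ p)%E.
  apply: gt0_ler_poweR; first exact: ltW.
  - by rewrite in_itv/= leey hilbert_operator_ge0.
  - by rewrite in_itv/= leey mule_ge0 ?poweR_ge0// lee_fin powR_ge0.
  - exact: hilbert_operator_le.
apply: (le_trans H); rewrite poweRM ?poweR_ge0 ?lee_fin ?powR_ge0//.
rewrite -poweRrM mulVf ?gt_eqF// poweRe1//.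
rewrite poweR_EFin -powRrM powRM ?powR_ge0//.
have -> : q^-1 * p = p - 1.
  by rewrite iqE mulrBl mul1r mulVf ?gt_eqF.
rewrite -powRrM (_ : - p^-1 * (p - 1) = - q^-1)//.
rewrite mulrBr mulNr mulVf ?gt_eqF// mulr1 opprK -pq.
by rewrite opprD addrAC addNr add0r.
Qed.

(** The second Schur integral, with [a = 1/p]: it yields [C0 * nu x^(- 1/q)], which cancels the
    weight [nu x^(1/q)]. Away from the origin this is an equality; at the origin [W] vanishes. *)
Let integral_W_le x : (\int[mu]_y (W x y)%:E <= (C0 `^ p * f x `^ p)%:E)%E.
Proof.
have C0p : C0 `^ p = C0 * C0 `^ (p - 1) by rewrite mulr_powRB1.
have [x0|x0] := eqVneq (nu x) 0.
  rewrite (eq_integral (cst 0%E)); first by rewrite integral0 lee_fin mulr_ge0 ?powR_ge0.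
  move=> y _; rewrite /W x0 powR0 ?mulr0 ?mul0r//.
  by rewrite invr_neq0// gt_eqF.
have {}x0 : 0 < nu x by rewrite lt_neqAle eq_sym x0 nu0.
rewrite (eq_integral (fun y => (f x `^ p * nu x `^ q^-1 * C0 `^ (p - 1))%:E *
  (br y * (nu y `^ (p^-1 - 1) / (nu y + nu x)))%:E)%E); last first.
  move=> y _; rewrite -EFinM /W (_ : p^-1 - 1 = - q^-1); last by rewrite iqE; ring.
  by congr EFin; rewrite [nu y + _]addrC; ring.
rewrite ge0_integralZl//.
- rewrite integral_ball_ratio_kernel// -EFinM lee_fin C0p.
  rewrite (_ : p^-1 - 1 = - q^-1); last by rewrite iqE; ring.
  have E : nu x `^ q^-1 * nu x `^ (- q^-1) = 1.
    by rewrite -powRD ?(gt_eqF x0) ?implybT// subrr powRr0.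
  move: E; set A := _ `^ q^-1; set B := nu x `^ _ => E.
  rewrite le_eqVlt; apply/orP; left; apply/eqP.
  transitivity (A * B * (C0 * C0 `^ (p - 1) * f x `^ p)); first by ring.
  by rewrite E mul1r.
- apply/measurable_EFinP/measurable_funM => //.
  apply: measurable_funM; first exact: mpowR.
  by apply: measurable_funV; exact: measurable_funD.
- move=> y _; rewrite lee_fin mulr_ge0// divr_ge0 ?powR_ge0// addr_ge0//.
- by rewrite lee_fin !mulr_ge0 ?powR_ge0.
Qed.

Lemma hilbert_leftP : hilbert_left G nu p q C0 f.
Proof.
rewrite /hilbert_left /Lp_norm.
have mW : measurable_fun setT (fun z : 'rV[R]_N * 'rV[R]_N => (W z.1 z.2)%:E).
  apply/measurable_EFinP/measurable_funM.
    apply: measurable_funM.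
      by apply: measurable_funM; [exact: (m1 (mpowR _ mf))|exact: (m1 (mpowR _ mnu))].
    by apply: measurable_funV; apply: measurable_funD; [exact: m1|exact: m2].
  apply: measurable_funM; last exact: m2.
  by apply: measurable_funM => //; exact: (m2 (mpowR _ mnu)).
have W0 z : (0 <= (W z.1 z.2)%:E)%E by rewrite lee_fin mulr_ge0.
have H : (\int[mu]_y (T y `^ p * (br y)%:E) <=
    (C0 `^ p)%:E * \int[mu]_x (f x `^ p)%:E)%E.
  apply: (@le_trans _ _ (\int[mu]_y \int[mu]_x (W x y)%:E)%E).
    apply: le_integral_nonmeasurable => y _ //.
    by rewrite mule_ge0 ?poweR_ge0// lee_fin.
  (* Tonelli: the first Schur integral was taken in [x] for fixed [y], the second is taken in [y]
     for fixed [x]. *)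
  rewrite -(fubini_tonelli (fun z => (W z.1 z.2)%:E))//=.
  rewrite -ge0_integralZl//.
  - apply: le_integral_nonmeasurable => x _; last by rewrite -EFinM.
    by apply: integral_ge0 => y _; exact: (W0 (x, y)).
  - by apply/measurable_EFinP; exact: mpowR.
  - by move=> x _; rewrite lee_fin powR_ge0.
  - by rewrite lee_fin powR_ge0.
have F0 : (0 <= \int[mu]_x (f x `^ p)%:E)%E.
  by apply: integral_ge0 => x _; rewrite lee_fin powR_ge0.
apply: (@le_trans _ _ (((C0 `^ p)%:E * \int[mu]_x (f x `^ p)%:E) `^ p^-1)%E).
  apply: gt0_ler_poweR => //; first by rewrite invr_ge0 ltW.
  - rewrite in_itv/= leey andbT; apply: integral_ge0 => y _.
    by rewrite mule_ge0 ?poweR_ge0// lee_fin.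
  - by rewrite in_itv/= leey andbT mule_ge0// lee_fin powR_ge0.
rewrite poweRM ?lee_fin ?powR_ge0// poweR_EFin -powRrM mulfV ?gt_eqF// powRr1//.
Qed.

(** Hoelder in [y], with the weight [br y^(1/p)] attached to the inner integral: its [p]-th power is
    the weight of (b). The constant is arbitrary, so that the lemma also serves the equivalences and
    the sharpness. *)
Lemma hilbert_left_double C (g : 'rV[R]_N -> R) :
  measurable_fun setT g -> (forall x, 0 <= g x) ->
  hilbert_left G nu p q C f -> hilbert_double G nu p q C f g.
Proof.
move=> mg g0 hl; rewrite /hilbert_double.
pose h y : \bar R := (T y * (br y `^ p^-1)%:E)%E.
have mh : measurable_fun setT h.
  apply: emeasurable_funM; first exact: measurable_hilbert_operator.
  by apply/measurable_EFinP; exact: mpowR.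
have h0 y : (0 <= h y)%E.
  by rewrite mule_ge0 ?hilbert_operator_ge0// lee_fin powR_ge0.
rewrite (eq_integral (fun y => h y * (g y)%:E)%E); last first.
  move=> y _; rewrite /h -muleA -EFinM -ge0_integralZr//.
  - by apply: eq_integral => x _; rewrite -EFinM; congr EFin; ring.
  - apply/measurable_EFinP/measurable_funM; last exact: mpowR.
    by apply: measurable_funM => //; apply: measurable_funV; exact: measurable_funD.
  - move=> x _; rewrite lee_fin mulr_ge0 ?powR_ge0// divr_ge0// addr_ge0//.
  - by rewrite lee_fin mulr_ge0 ?powR_ge0.
apply: (le_trans (ehoelder_ge0 mu p0 q0 pq mh mg h0 g0)).
rewrite /Lp_norm lee_wpmul2r ?poweR_ge0//; apply: le_trans hl.
rewrite le_eqVlt; apply/orP; left; apply/eqP; congr (_ `^ _)%E.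
apply: eq_integral => y _; rewrite /h poweRM ?hilbert_operator_ge0 ?lee_fin ?powR_ge0//.
by rewrite poweR_EFin -powRrM mulVf ?gt_eqF// powRr1.
Qed.

End hilbert_inequality.

(** * Sharpness of the constant *)

Definition itv_indic (R : realType) (a b t : R) : R := (a <= t <= b)%R%:R.

Section sharpness.
Context {R : realType} {N : nat} (G : homogeneousGroup R N) (nu : 'rV[R]_N -> R).
Hypothesis hnu : is_quasi_norm G nu.
Variable sigma : {finite_measure set 'rV[R]_N -> \bar R}.
Hypothesis hsigma : is_polar_measure G nu sigma.
Local Notation mu := (lebesgueRn R N).
Local Notation leb := (@lebesgue_measure R).
Local Notation Q := (hdim G).
Local Notation br := (ball_ratio G nu).
Local Notation c := (sphere_mass nu sigma).

Let nu0 x : 0 <= nu x. Proof. exact: (qnorm_ge0 hnu x). Qed.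
Let br0 x : 0 <= br x. Proof. exact: (ball_ratio_ge0 hnu hsigma x). Qed.
Let mnu : measurable_fun setT nu. Proof. exact: (measurable_qnorm hnu). Qed.
Let Q0 : 0 < Q. Proof. exact: (hdim_gt0 hnu hsigma). Qed.
Let c0 : 0 < c. Proof. exact: (sphere_mass_gt0 hnu hsigma). Qed.


Let measurable_itv_indic a b : measurable_fun setT (@itv_indic R a b).
Proof.
by apply: measurable_natr; apply: measurable_and; exact: measurable_fun_ler.
Qed.

Lemma integral_itv_indic (a b : R) (h : R -> R) : 0 < a ->
  (\int[leb]_(t in `]0%R, +oo[) (itv_indic a b t * h t)%:E =
   \int[leb]_(t in `[a, b]) (h t)%:E)%E.
Proof.
move=> a0; rewrite (_ : `[a, b]%classic = `]0, +oo[%classic `&` [set t | a <= t <= b]).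
  rewrite integral_mkcondr; apply: eq_integral => t _.
  rewrite patchE /itv_indic; case: ifPn => [/set_mem/= ->|]; first by rewrite mul1r.
  by rewrite notin_setE/= => /negP/negbTE ->; rewrite mul0r.
apply/seteqP; split => t /=; rewrite !in_itv/= andbT; last by case.
by move=> /andP[at_ ->]; rewrite at_; split => //; exact: (lt_le_trans a0 at_).
Qed.

(** In polar coordinates [|x|^(- Q)] becomes [dr / r], whence the logarithms. This gives the norms
    of the test functions and also the outer integral in the lower bound. *)
Lemma integral_qnorm_shell k a b : 0 <= k -> 0 < a -> a < b ->
  (\int[mu]_x (k * nu x `^ (- Q) * itv_indic a b (nu x))%:E =
   (k * c * (ln b - ln a))%:E)%E.
Proof.
move=> k_ge0 a0 ab.
pose phi t : R := k * t `^ (- Q) * itv_indic a b t.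
have phi0 t : 0 <= phi t by rewrite !mulr_ge0 ?powR_ge0// /itv_indic ler0n.
have mphi : measurable_fun setT phi.
  by apply: measurable_funM => //; apply: measurable_funM => //; exact: measurable_powR.
rewrite (radial_polar hnu hsigma mphi phi0).
transitivity (\int[leb]_(t in `]0%R, +oo[) (itv_indic a b t * (k * c * t^-1))%:E)%E.
  apply: eq_integral => t /set_mem/=; rewrite in_itv/= andbT => t0.
  rewrite -EFinM; congr EFin; rewrite /phi.
  have H : t `^ (- Q) * t `^ (Q - 1) = t^-1.
    rewrite -powRD ?(gt_eqF t0) ?implybT// addrA addNr add0r powR_inv1 ?ltW//.
  by rewrite -H; ring.
rewrite integral_itv_indic//.
under eq_integral do rewrite EFinM.
rewrite ge0_integralZl//.
- by rewrite integral_invr_itv// -EFinM.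
- by apply/measurable_EFinP/measurable_funTS/measurable_funV.
- move=> t /=; rewrite in_itv/= => /andP[at_ _].
  by rewrite lee_fin invr_ge0 (le_trans (ltW a0)).
- by rewrite lee_fin mulr_ge0// ltW.
Qed.

(** The exponent is critical: the [p]-th power [|x|^(- Q)] diverges logarithmically both at the
    origin and at infinity, and the shell cuts off both ends. *)
Definition shell_fun (p M : R) (x : 'rV[R]_N) : R :=
  nu x `^ (- (Q / p)) * itv_indic 1 M (nu x).

Lemma shell_fun_ge0 p M x : 0 <= shell_fun p M x.
Proof. by rewrite mulr_ge0 ?powR_ge0// /itv_indic ler0n. Qed.

Lemma measurable_shell_fun p M : measurable_fun setT (shell_fun p M).
Proof.
apply: measurable_funM; last exact: measurableT_comp.
exact: (measurableT_comp (@measurable_powR R _) mnu).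
Qed.

Lemma radial_mean_shell_fun p M r : p != 0 -> 0 < r ->
  radial_mean G nu sigma p (shell_fun p M) r =
    (c * r `^ (- p^-1) * itv_indic 1 M r)%:E.
Proof.
move=> p0 r0; rewrite /radial_mean.
rewrite (eq_integral (cst (r `^ (- (Q / p)) * itv_indic 1 M r)%:E)); last first.
  by move=> y /set_mem Sy; rewrite /shell_fun/= (qnorm_dil hnu)// Sy mulr1.
rewrite (@integral_cst _ _ _ sigma _ (measurable_qsphere hnu)
  (r `^ (- (Q / p)) * itv_indic 1 M r)%:E) [X in (_ * (_ * X))%E](sphere_massE hnu).
rewrite -!EFinM; congr EFin.
rewrite (_ : - p^-1 = (Q - 1) / p + - (Q / p)); last by field.
by rewrite powRD ?(gt_eqF r0) ?implybT//; ring.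
Qed.

(** The radial mean is [c * t^(- 1/p)] on [[1, M]] and zero elsewhere; since [t >= 1] it is at most
    [c], on an interval of finite length. *)
Lemma admissible_shell_fun p M : 1 < p -> admissible G nu sigma p (shell_fun p M).
Proof.
move=> p1; have pn0 : p != 0 by rewrite gt_eqF//; lra.
split; [exact: measurable_shell_fun|exact: shell_fun_ge0|].
pose F t : R := c * t `^ (- p^-1) * itv_indic 1 M t.
have FE t : t \in `]0%R, +oo[%classic ->
    (F t)%:E = radial_mean G nu sigma p (shell_fun p M) t.
  by move=> /set_mem/=; rewrite in_itv/= andbT => t0; rewrite radial_mean_shell_fun.
split.
  apply: (eq_measurable_fun (EFin \o F)) => //.
  apply/measurable_EFinP/measurable_funTS/measurable_funM => //.
  by apply: measurable_funM => //; exact: measurable_powR.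
rewrite unlock; apply: poweR_lty.
apply: (@le_lt_trans _ _ (\int[leb]_(t in `[1%R, M]) (c `^ p)%:E)%E).
  rewrite [leRHS]integral_mkcond; apply: le_integral_nonmeasurable => t _.
    exact: poweR_ge0.
  rewrite patchE; case: ifPn => [/FE <-|_]; last first.
    rewrite abse0 poweR0r// patchE; case: ifPn => // _.
    by rewrite lee_fin powR_ge0.
  rewrite patchE /F /itv_indic; case: ifPn => [/set_mem/=|].
    rewrite in_itv/= => /andP[t1 tM]; rewrite t1 tM/= mulr1.
    have t0 : 0 < t by lra.
    rewrite ger0_norm ?mulr_ge0 ?powR_ge0 ?(ltW c0)//. rewrite lee_fin.
    apply: ge0_ler_powR; rewrite ?nnegrE ?mulr_ge0 ?powR_ge0 ?(ltW c0)//; first lra.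
    rewrite -[leRHS]mulr1 ler_pM2l//.
    by rewrite -[leRHS](powRr0 t) ler_powR// oppr_le0 invr_ge0; lra.
  rewrite notin_setE/= in_itv/= => /negP/negbTE ->.
  by rewrite mulr0 /= normr0 powR0// gt_eqF//; lra.
rewrite integral_cst//= lebesgue_measure_itv/=.
by case: ifP => _; rewrite ?mule0// -EFinB -EFinM ltry.
Qed.

Lemma Lp_norm_shell_fun p M : 0 < p -> 1 < M ->
  Lp_norm p (shell_fun p M) = ((c * ln M) `^ p^-1)%:E.
Proof.
move=> p0 M1; rewrite /Lp_norm.
rewrite (eq_integral (fun x => (1 * nu x `^ (- Q) * itv_indic 1 M (nu x))%:E)).
  by rewrite integral_qnorm_shell// ln1 subr0 mul1r.
move=> x _; congr EFin; rewrite /shell_fun powRM ?powR_ge0 ?ler0n//.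
rewrite -powRrM mul1r mulNr divfK ?gt_eqF//; congr (_ * _).
by rewrite /itv_indic; case: (_ && _); rewrite ?powR1// powR0 ?gt_eqF.
Qed.

(** * Lower bound for the double integral of two shell functions *)

Section lower_bound.
Variables p q : R.
Hypotheses (p1 : 1 < p) (q1 : 1 < q) (pq : p^-1 + q^-1 = 1).

Let pE : p^-1 = 1 - q^-1. Proof. by rewrite -pq addrK. Qed.

Let p0 : 0 < p. Proof. exact: (lt_trans ltr01 p1). Qed.
Let q0 : 0 < q. Proof. exact: (lt_trans ltr01 q1). Qed.
Let iq01 : 0 < q^-1 < 1. Proof. by rewrite invr_gt0 q0 invf_lt1. Qed.

Let A (K : R) : R := fine (\int[leb]_(t in `[(K^-1)%R, K%R])
  (t `^ (q^-1 - 1) / (1 + t))%:E)%E.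

Let beta_trunc K : 1 <= K ->
  (\int[leb]_(t in `[(K^-1)%R, K%R]) (t `^ (q^-1 - 1) / (1 + t))%:E = (A K)%:E)%E.
Proof.
move=> K1; rewrite fineK// ge0_fin_numE; last first.
  apply: integral_ge0 => t /=; rewrite in_itv/= => /andP[Kt _].
  have t0 : 0 < t by rewrite (lt_le_trans _ Kt)// invr_gt0; lra.
  by rewrite lee_fin divr_ge0 ?powR_ge0//; lra.
apply: (@le_lt_trans _ _ (\int[leb]_(t in `]0%R, +oo[)
    (t `^ (q^-1 - 1) / (1 + t))%:E)%E).
  apply: ge0_subset_integral => //.
  - exact: measurable_beta_integrand.
  - move=> t /=; rewrite in_itv/= andbT => t0.
    by rewrite lee_fin divr_ge0 ?powR_ge0//; lra.
  - move=> t /=; rewrite !in_itv/= andbT => /andP[Kt _].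
    by rewrite (lt_le_trans _ Kt)// invr_gt0; lra.
by rewrite integral_beta ?ltry.
Qed.

(** For [K <= |y| <= M / K], the substitution [r = |y| * t] sends [[1/K, K]] into [[1, M]], so the
    shell does not cut the truncated beta integral [A K]. *)
Lemma shell_inner_integral_ge K M y : 1 <= K -> K <= nu y -> nu y <= M / K ->
  ((Q * A K * nu y `^ (- Q))%:E <=
   \int[mu]_x (shell_fun p M x * shell_fun q M y / (nu x + nu y) *
     br x `^ q^-1 * br y `^ p^-1)%:E)%E.
Proof.
move=> K1 Ky yM; set s := nu y in Ky yM *.
have s0 : 0 < s by lra.
have K0 : 0 < K by lra.
have sKM : s * K <= M by rewrite -ler_pdivlMr.
have sM : s <= M by apply: le_trans sKM; rewrite ler_peMr// ltW.
have brE x : 0 < nu x -> br x = Q / c * nu x `^ (1 - Q).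
  by move=> x0; rewrite (ball_ratioE hnu hsigma) (radial_ratioE hnu hsigma).
have Qc0 : 0 < Q / c by rewrite divr_gt0.
(* Everything independent of [x]: the constants of the two ball ratios combine to [Q / c] because
   [1/p + 1/q = 1], and the powers of [s] to [s^(1/p - Q)]. *)
pose k : R := Q / c * s `^ (p^-1 - Q).
have k0 : 0 <= k by rewrite mulr_ge0 ?powR_ge0// ltW.
pose phi t : R := k * t `^ (q^-1 - Q) / (t + s) * itv_indic 1 M t.
have phi0 t : 0 <= phi t.
  rewrite /phi /itv_indic; have [t1|t1] := leP 1 t; last by rewrite mulr0.
  rewrite mulr_ge0 ?ler0n// divr_ge0//; last by rewrite addr_ge0//; lra.
  by apply: mulr_ge0 => //; exact: powR_ge0.
have mphi : measurable_fun setT phi.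
  apply: measurable_funM => //; apply: measurable_funM.
    by apply: measurable_funM => //; exact: measurable_powR.
  by apply: measurable_funV; exact: measurable_funD.
rewrite (eq_integral (fun x => (phi (nu x))%:E)); last first.
  move=> x _; congr EFin; rewrite /shell_fun -/s /phi.
  rewrite [itv_indic 1 M s](_ : _ = 1); last by rewrite /itv_indic sM (le_trans K1).
  rewrite /itv_indic; have [x1|_] := leP 1 (nu x); last by rewrite /= !(mulr0, mul0r).
  have r0 : 0 < nu x by lra.
  rewrite (brE _ r0) (brE y)// -/s.
  move: (nu x) r0 {x1} => r r0.
  rewrite 2!(powRM _ (ltW Qc0) (powR_ge0 _ _)) -!powRrM.
  have E1 : (Q / c) `^ q^-1 * (Q / c) `^ p^-1 = Q / c.
    by rewrite -powRD ?(gt_eqF Qc0) ?implybT// addrC pq powRr1// ltW.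
  have E2 : r `^ (- (Q / p)) * r `^ ((1 - Q) * q^-1) = r `^ (q^-1 - Q).
    rewrite -powRD ?(gt_eqF r0) ?implybT// pE; congr (_ `^ _).
    by ring.
  have E3 : s `^ (- (Q / q)) * s `^ ((1 - Q) * p^-1) = s `^ (p^-1 - Q).
    rewrite -powRD ?(gt_eqF s0) ?implybT// pE; congr (_ `^ _).
    by ring.
  by rewrite /k -E2 -E3 -[in RHS]E1; ring.
rewrite (radial_polar hnu hsigma mphi phi0).
pose psi t : R := k * c * (t `^ (q^-1 - 1) / (t + s)).
have psi0 t : 0 < t -> 0 <= psi t.
  move=> t0; apply: mulr_ge0; first by apply: mulr_ge0 => //; exact: ltW.
  by rewrite divr_ge0 ?powR_ge0// ltW// addr_gt0.
have mpsi (D : set R) : measurable_fun D (EFin \o psi).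
  apply/measurable_EFinP/measurable_funTS/measurable_funM => //.
  apply: measurable_funM; first exact: measurable_powR.
  by apply: measurable_funV; exact: measurable_funD.
rewrite (_ : (\int[leb]_(t in `]0%R, +oo[) ((phi t * t `^ (Q - 1))%:E * c%:E) =
    \int[leb]_(t in `]0%R, +oo[) (itv_indic 1 M t * psi t)%:E)%E); last first.
  apply: eq_integral => t /set_mem/=; rewrite in_itv/= andbT => t0.
  rewrite -EFinM; congr EFin; rewrite /phi /psi.
  have E : t `^ (q^-1 - Q) * t `^ (Q - 1) = t `^ (q^-1 - 1).
    by rewrite -powRD ?(gt_eqF t0) ?implybT// addrA subrK.
  by rewrite -E; ring.
rewrite integral_itv_indic//.
have sK0 : 0 < s / K by rewrite divr_gt0.
apply: (@le_trans _ _ (\int[leb]_(t in `[(s / K)%R, (s * K)%R]) (psi t)%:E)%E);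
  last first.
  apply: ge0_subset_integral => //.
  - exact: mpsi.
  - by move=> t /=; rewrite in_itv/= => /andP[t1 _]; rewrite lee_fin psi0//; lra.
  - apply: subset_itvScc; rewrite bnd_simp//.
    by rewrite ler_pdivlMr// mul1r.
under eq_integral do rewrite /psi EFinM.
rewrite ge0_integralZl//.
- rewrite hilbert_kernel_dilation//; last first.
    by move=> t /=; rewrite !in_itv/= andbT => /andP[st _]; exact: (lt_le_trans sK0).
  rewrite (_ : *%R s @^-1` _ = `[K^-1, K]%classic); last first.
    apply/seteqP; split => t /=; rewrite !in_itv/=.
      by rewrite !ler_pM2l.
    by rewrite !ler_pM2l.
  rewrite beta_trunc// -!EFinM lee_fin le_eqVlt; apply/orP; left; apply/eqP.
  have E : s `^ (p^-1 - Q) * s `^ (q^-1 - 1) = s `^ (- Q).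
    rewrite -powRD ?(gt_eqF s0) ?implybT// pE; congr (_ `^ _).
    by ring.
  rewrite -E /k.
  by field; rewrite gt_eqF.
- apply/measurable_EFinP/measurable_funTS/measurable_funM.
    exact: measurable_powR.
  by apply: measurable_funV; exact: measurable_funD.
- move=> t /=; rewrite in_itv/= => /andP[st _].
  have t0 : 0 < t by exact: (lt_le_trans sK0).
  by rewrite lee_fin divr_ge0 ?powR_ge0//; lra.
- by rewrite lee_fin mulr_ge0// ltW.
Qed.

Let inequality C := forall f g : 'rV[R]_N -> R,
  admissible G nu sigma p f -> admissible G nu sigma q g ->
  hilbert_double G nu p q C f g.

Let shell_bound C K m : 1 < K -> inequality C -> (2 < m)%N ->
  Q * A K * (m%:R - 2) <= C * m%:R.
Proof.
move=> K1 HC m2; set M := K ^+ m.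
have K0 : 0 < K by lra.
have lnK : 0 < ln K by rewrite ln_gt0.
have lnM : ln M = m%:R * ln K by rewrite lnXn// mulr_natl.
have M1 : 1 < M by rewrite exprn_egt1// gtn_eqF// (ltn_trans _ m2).
have := HC _ _ (admissible_shell_fun M p1) (admissible_shell_fun M q1).
have KM : K < M / K.
  rewrite ltr_pdivlMr// -expr2 /M.
  by rewrite ltr_eXn2l.
have A0 : 0 <= A K.
  rewrite fine_ge0//; apply: integral_ge0 => t /=; rewrite in_itv/= => /andP[Kt _].
  have t0 : 0 < t by rewrite (lt_le_trans _ Kt)// invr_gt0.
  by rewrite lee_fin divr_ge0 ?powR_ge0//; lra.
have k0 : 0 <= Q * A K by rewrite mulr_ge0// ltW.
rewrite /hilbert_double !Lp_norm_shell_fun//.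
have cM0 : 0 < c * ln M by rewrite mulr_gt0// ln_gt0.
(* The two norms multiply to [c * ln M] because [1/p + 1/q = 1]. *)
rewrite -muleA -EFinM -powRD ?(gt_eqF cM0) ?implybT// pq powRr1 ?(ltW cM0)//.
move=> H.
have : ((Q * A K * c * (ln (M / K) - ln K))%:E <= (C * (c * ln M))%:E)%E.
  apply: le_trans H; rewrite -integral_qnorm_shell//.
  apply: le_integral_nonmeasurable => y _.
    by rewrite lee_fin mulr_ge0 ?ler0n//; apply: mulr_ge0 => //; exact: powR_ge0.
  rewrite [itv_indic _ _ _]/itv_indic.
  have [/andP[Ky yM]|_] := boolP (K <= nu y <= M / K).
    by rewrite mulr1; apply: shell_inner_integral_ge => //; exact: ltW.
  rewrite mulr0; apply: integral_ge0 => x _.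
  rewrite lee_fin mulr_ge0 ?powR_ge0// mulr_ge0 ?powR_ge0//.
  by rewrite divr_ge0 ?addr_ge0// mulr_ge0 ?shell_fun_ge0.
rewrite lee_fin ln_div ?posrE//; last by rewrite (lt_trans ltr01).
rewrite lnM => H2.
rewrite -(ler_pM2r (mulr_gt0 c0 lnK)).
by move: H2; congr (_ <= _); ring.
Qed.

Lemma hilbert_double_sharp C : inequality C -> Q * pi / sin (pi / p) <= C.
Proof.
move=> HC.
have QA n : Q * A n.+2%:R <= C.
  have K1 : 1 < n.+2%:R :> R by rewrite ltr1n.
  rewrite leNgt; apply/negP => CQA.
  pose d := Q * A n.+2%:R - C.
  have d0 : 0 < d by rewrite subr_gt0.
  (* If [C] fell short by [d], [shell_bound] would give [m * d <= 2 * Q * A]; this [m] is large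
     enough to contradict that, and the added 3 ensures [2 < m]. *)
  pose m := (Num.truncn (2 * `|Q * A n.+2%:R| / d)).+3.
  have := shell_bound K1 HC (isT : (2 < m)%N).
  have : 2 * `|Q * A n.+2%:R| / d < m%:R.
    by apply: lt_trans (truncnS_gt _) _; rewrite ltr_nat.
  rewrite ltr_pdivrMr// /d.
  have := ler_norm (Q * A n.+2%:R); move: (m%:R) (Q * _) => M u.
  by move: (`|u|) => v; nra.
have HA : (A n.+2%:R)%:E @[n --> \oo] --> (pi / sin (pi / q))%:E.
  rewrite (_ : (fun n => _) = (fun n => (\int[leb]_(t in `[(n.+2%:R^-1)%R, n.+2%:R%R])
    (t `^ (q^-1 - 1) / (1 + t))%:E)%E)); first exact: cvg_integral_beta_trunc.
  by apply/funext => n; rewrite beta_trunc// ler1n.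
have /fine_cvgP[_ HA'] := HA.
(* The beta integral has parameter [1/q], so its limit carries [sin (pi / q)], equal to
   [sin (pi / p)]. *)
rewrite -(sin_conjugate pq) -mulrA.
apply: (@cvgr_to_le _ \oo _ R (fun n => Q * A n.+2%:R)).
  by apply: cvgM; first exact: cvg_cst.
exact: nearW.
Qed.

End lower_bound.

End sharpness.

(** * Symmetry between (b) and (c), and assembly of the theorem *)

(** The kernel is symmetric, so every result on (b) serves for (c) after exchanging the
    exponents. *)
Lemma hilbert_rightE (R : realType) (N : nat) (G : homogeneousGroup R N)
    (nu : 'rV[R]_N -> R) (p q C : R) (g : 'rV[R]_N -> R) :
  hilbert_right G nu p q C g = hilbert_left G nu q p C g.
Proof.
have E x : (\int[lebesgueRn R N]_y (g y / (nu x + nu y) * ball_ratio G nu y `^ p^-1)%:E =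
    \int[lebesgueRn R N]_y (g y / (nu y + nu x) * ball_ratio G nu y `^ p^-1)%:E)%E.
  by apply: eq_integral => y _; rewrite [nu x + _]addrC.
by rewrite /hilbert_right; under eq_integral do rewrite E.
Qed.

Lemma hilbert_left_mono (R : realType) (N : nat) (G : homogeneousGroup R N)
    (nu : 'rV[R]_N -> R) (p q C D : R) (f : 'rV[R]_N -> R) :
  C <= D -> hilbert_left G nu p q C f -> hilbert_left G nu p q D f.
Proof.
move=> CD /le_trans; apply.
by rewrite lee_wpmul2r ?lee_fin// poweR_ge0.
Qed.

Theorem theorem3p1 (R : realType) (N : nat) (G : homogeneousGroup R N)
    (nu : 'rV[R]_N -> R) (hnu : is_quasi_norm G nu)
    (sigma : {finite_measure set 'rV[R]_N -> \bar R})
    (hsigma : is_polar_measure G nu sigma)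
    (p q : R) (hp : 1 < p) (hq : q = p / (p - 1)) :
  let C0 := hdim G * pi / sin (pi / p) in
  let adm := admissible G nu sigma in
  let ineq_a (C : R) := forall f g, adm p f -> adm q g ->
    hilbert_double G nu p q C f g in
  let ineq_b (C : R) := forall f, adm p f -> hilbert_left G nu p q C f in
  let ineq_c (C : R) := forall g, adm q g -> hilbert_right G nu p q C g in
  [/\ ineq_a C0, ineq_b C0 & ineq_c C0] /\
  (forall C : R, (ineq_b C <-> ineq_a C) /\ (ineq_c C <-> ineq_a C)) /\
  [/\ forall C : R, C < C0 -> ~ ineq_a C,
      forall C : R, C < C0 -> ~ ineq_b C
    & forall C : R, C < C0 -> ~ ineq_c C].
Proof.
move=> C0 adm ineq_a ineq_b ineq_c.
have p0 : 0 < p by lra.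
have q1 : 1 < q by rewrite hq ltr_pdivlMr; lra.
have q0 : 0 < q by lra.
have pq : p^-1 + q^-1 = 1 by rewrite hq; field; lra.
have qp : q^-1 + p^-1 = 1 by rewrite addrC.
have C0E : C0 = hdim G * pi / sin (pi / q) by rewrite (sin_conjugate pq).
have b_ge C : C0 <= C -> ineq_b C.
  move=> CC f [mf f0 _]; apply: hilbert_left_mono CC _.
  exact: (hilbert_leftP hnu hsigma).
have c_ge C : C0 <= C -> ineq_c C.
  move=> CC g [mg g0 _]; rewrite /= hilbert_rightE.
  apply: hilbert_left_mono CC _; rewrite C0E.
  exact: (hilbert_leftP hnu hsigma).
have b_a C : ineq_b C -> ineq_a C.
  move=> hb f g af [mg g0 _]; case: (af) => mf f0 _.
  by apply: (hilbert_left_double hnu hsigma) => //; exact: hb.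
have a_le C : ineq_a C -> C0 <= C.
  exact: (hilbert_double_sharp hnu hsigma hp q1 pq).
(* Read as (b) for the exponents [(q, p)], (c) implies (a) with [f] and [g] exchanged. The sharpness
   of that form is enough, so the order of integration in (a) need not be swapped. *)
have c_le C : ineq_c C -> C0 <= C.
  move=> hc; rewrite C0E; apply: (hilbert_double_sharp hnu hsigma q1 hp qp).
  move=> g f ag [mf f0 _]; case: (ag) => mg g0 _.
  apply: (hilbert_left_double hnu hsigma) => //.
  by rewrite -hilbert_rightE; exact: hc.
have b_le C : ineq_b C -> C0 <= C by move=> /b_a /a_le.
split; first by split; [apply: b_a| |]; [exact: b_ge|exact: b_ge|exact: c_ge].
split=> [C|].
  split; split=> [|/a_le]; [exact: b_a|exact: b_ge| |exact: c_ge].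
  (* From (c) to (a) through [C0 <= C], which gives (b) and then (a) with the same [C]. *)
  by move=> /c_le /b_ge /b_a.
by split=> C CC0 H; move: CC0; rewrite ltNge => /negP; apply;
  [exact: a_le|exact: b_le|exact: c_le].
Qed.
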